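(* There exist a compact boundaryless surface $M$ and a homeomorphism $f\colon M\to M$ that is $2$-expansive but not expansive.
   Context: For a homeomorphism $f\colon X\to X$ of a compact metric space $(X,d)$, $x\in X$ and $\epsilon>0$, put $\Gamma_\epsilon(x)=\{y\in X: d(f^n(x),f^n(y))\le \epsilon \text{ for all } n\in\mathbb{Z}\}$. For a positive integer $n$, $f$ is $n$-expansive if there is $\alpha>0$ such that $\Gamma_\alpha(x)$ has at most $n$ elements for every $x\in X$. The homeomorphism $f$ is expansive if there is $\alpha>0$ such that $\Gamma_\alpha(x)=\{x\}$ for every $x\in X$. *)

(* Defs.v *)
From HB Require Import structures.
From mathcomp Require Import all_boot all_order all_algebra.
From mathcomp Require Import all_classical all_reals all_analysis.

Set Implicit Arguments.
Unset Strict Implicit.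
Unset Printing Implicit Defensive.

Import Order.TTheory GRing.Theory Num.Theory.
Import numFieldNormedType.Exports.

Local Open Scope classical_set_scope.
Local Open Scope ring_scope.

Record homeomorphism (X Y : topologicalType) := Homeomorphism {
  homeo_fun :> X -> Y ;
  homeo_inv : Y -> X ;
  homeo_funK : cancel homeo_fun homeo_inv ;
  homeo_invK : cancel homeo_inv homeo_fun ;
  homeo_fun_continuous : continuous homeo_fun ;
  homeo_inv_continuous : continuous homeo_inv
}.

(* [Negz k] is the integer -(k+1). *)
Definition ziter (X : topologicalType) (f : homeomorphism X X) (n : int)
    : X -> X :=
  match n with
  | Posz k => iter k f
  | Negz k => iter k.+1 (homeo_inv f)
  end.

Definition Gamma (R : realType) (X : metricType R) (f : homeomorphism X X)
    (e : R) (x : X) : set X :=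
  [set y | forall n : int, mdist (ziter f n x) (ziter f n y) <= e].

Definition n_expansive (R : realType) (X : metricType R) (n : nat)
    (f : homeomorphism X X) : Prop :=
  exists2 alpha : R, 0 < alpha &
    forall x : X, (Gamma f alpha x #<= `I_n)%card.

Definition expansive (R : realType) (X : metricType R)
    (f : homeomorphism X X) : Prop :=
  exists2 alpha : R, 0 < alpha & forall x : X, Gamma f alpha x = [set x].

(* [phi] and [psi] are total functions, but only their restrictions to [U] and
   [V] matter: these are mutually inverse homeomorphisms between [U] and [V]. *)
Definition homeomorphic_via (X Y : topologicalType) (U : set X) (V : set Y)
    (phi : X -> Y) (psi : Y -> X) : Prop :=
  [/\ {within U, continuous phi},
      {within V, continuous psi},
      forall x, U x -> V (phi x) /\ psi (phi x) = x &
      forall y, V y -> U (psi y) /\ phi (psi y) = y].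

(* Charts onto open subsets of the whole plane (rather than of a half-plane)
   express the absence of boundary. *)
Definition locally_planar (R : realType) (M : topologicalType) : Prop :=
  forall x : M, exists (U : set M) (V : set (R * R)%type)
      (phi : M -> (R * R)%type) (psi : (R * R)%type -> M),
    [/\ open U, U x, open V & homeomorphic_via U V phi psi].

(* Being Hausdorff and second countable is automatic for a compact metric
   space. *)
Definition compact_boundaryless_surface (R : realType) (M : metricType R)
    : Prop :=
  [/\ compact [set: M], connected [set: M] & locally_planar R M].

(* Main.v *)
(* The surface is a connected sum of two tori. The first one carries a map g
   derived from an Anosov automorphism: everywhere g multiplies the unstable
   coordinate u by lam = 2 + sqrt 3, it is the dilation z |-> lam z on a ball W
   around the origin, and outside W it contracts the stable coordinate s. The
   second torus carries g^-1, with u and s exchanged by a reflection. Cutting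
   out a disc around both origins and gluing along the inversion
   z |-> z / |z|^2, which turns the dilation by lam into the one by 1 / lam,
   gives a homeomorphism of a surface of genus two.

   If two orbits stay close in the future, inside the first torus, then their
   u-difference is bounded and multiplied by lam at each step, so it vanishes;
   in the past the same holds for the stable coordinate on the second torus.
   An orbit that never leaves the first torus avoids W, so s-differences grow
   in the past and an orbit staying close to it coincides with it. Any other
   orbit (up to symmetry) crosses the gluing annulus, where the points that
   stay close to it lie on a vertical line u = c and on the image under the
   inversion of a horizontal line: these meet at most twice. They are tangent
   at some point, and two nearby points of intersection close to the tangency
   have orbits that stay as close as desired, so the map is not expansive. *)
Require Import Defs.
From HB Require Import structures.
From mathcomp Require Import all_boot all_order all_algebra.
From mathcomp Require Import all_classical all_reals all_analysis.
From mathcomp Require Import ring lra.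

Set Implicit Arguments.
Unset Strict Implicit.
Unset Printing Implicit Defensive.

Import Order.TTheory GRing.Theory Num.Theory.
Import numFieldNormedType.Exports.

Local Open Scope classical_set_scope.
Local Open Scope ring_scope.

(** * The flat torus *)

Section Torus.
Context {R : realType}.
Implicit Types (x y P : R) (z w v : R * R).

Lemma prod_norm_le v (e : R) :
  (`|v| <= e) = [&& - e <= v.1, v.1 <= e, - e <= v.2 & v.2 <= e].
Proof. by rewrite prod_normE ge_max !ler_norml -!andbA. Qed.

Lemma prod_norm_lt v (e : R) :
  (`|v| < e) = [&& - e < v.1, v.1 < e, - e < v.2 & v.2 < e].
Proof. by rewrite prod_normE gt_max !ltr_norml -!andbA. Qed.

Definition wrap1 P x : R := x - P * (Num.floor (x / P + 2^-1))%:~R.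

Lemma wrap1_bounds P x : 0 < P -> - (P / 2) <= wrap1 P x < P / 2.
Proof.
move=> P0; rewrite /wrap1; set m := Num.floor _.
have /andP[] : m%:~R <= x / P + 2^-1 < (m + 1)%:~R := floor_itv _.
rewrite intrD -(ler_pM2l P0) -(ltr_pM2l P0) mulrDr mulrCA divff ?gt_eqF// mulr1.
by rewrite mulrDr mulr1 => ? ?; apply/andP; split; lra.
Qed.

Lemma wrap1_uniq P x y (m : int) :
  0 < P -> - (P / 2) <= y < P / 2 -> x = y + P * m%:~R -> wrap1 P x = y.
Proof.
move=> P0 /andP[y1 y2] ->; rewrite /wrap1 (_ : Num.floor _ = m) ?addrK//.
apply: floor_def; rewrite mulrDl mulrAC divff ?gt_eqF// mul1r intrD.
have y3 : - 2^-1 <= y / P by rewrite ler_pdivlMr//; lra.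
have y4 : y / P < 2^-1 by rewrite ltr_pdivrMr//; lra.
by apply/andP; split; lra.
Qed.

Lemma wrap1_ex P x : exists m : int, wrap1 P x = x + P * m%:~R.
Proof. by eexists (- _); rewrite mulrNz mulrN. Qed.

Lemma wrap1P P x y : 0 < P ->
  wrap1 P x = wrap1 P y <-> exists m : int, x = y + P * m%:~R.
Proof.
move=> P0; split=> [|[m ->]].
  have [m ->] := wrap1_ex P x; have [n ->] := wrap1_ex P y => e.
  by exists (n - m); rewrite intrB; lra.
have [n e] := wrap1_ex P y; apply: (@wrap1_uniq _ _ _ (m - n)) => //.
  exact: wrap1_bounds.
by rewrite e intrB; lra.
Qed.

(** The wrapped value is at most P / 2 in absolute value, and every other representative differs
    from it by at least P. *)
Lemma wrap1_min P x (m : int) : 0 < P -> `|wrap1 P x| <= `|x + P * m%:~R|.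
Proof.
move=> P0; have [n e] := wrap1_ex P x; have /andP[b1 b2] := wrap1_bounds x P0.
have -> : x + P * m%:~R = wrap1 P x + P * (m - n)%:~R by rewrite e intrB; lra.
set k := m - n.
have [->|k0] := eqVneq k 0; first by rewrite mulr0 addr0.
have k1 : 1 <= `|k%:~R : R| by rewrite norm_intr_ge1 ?intr_int// intr_eq0.
have Pk : P <= `|P * k%:~R| by rewrite normrM gtr0_norm// ler_pMr.
have w1 : `|wrap1 P x| <= P / 2 by rewrite ler_norml; apply/andP; split; lra.
have := lerB_normD (P * k%:~R) (wrap1 P x).
by rewrite [P * _ + _]addrC; lra.
Qed.

Lemma wrap1D_le P x y : 0 < P -> `|wrap1 P (x + y)| <= `|wrap1 P x| + `|wrap1 P y|.
Proof.
move=> P0; have [m em] := wrap1_ex P x; have [n en] := wrap1_ex P y.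
apply: le_trans (ler_normD _ _); apply: le_trans (wrap1_min _ (m + n) P0) _.
by rewrite em en intrD mulrDr addrACA.
Qed.

Lemma wrap1N_le P x : 0 < P -> `|wrap1 P (- x)| <= `|wrap1 P x|.
Proof.
move=> P0; have [m em] := wrap1_ex P x.
by rewrite (le_trans (wrap1_min _ (- m) P0))// em mulrNz mulrN -opprD normrN.
Qed.

(** * The lattice and the torus norm *)

Definition sqrt3 : R := Num.sqrt 3.

Lemma sqrt3_sqr : sqrt3 * sqrt3 = 3.
Proof. by rewrite -expr2 sqr_sqrtr. Qed.

Lemma sqrt3_bounds : 17 / 10 < sqrt3 < 18 / 10.
Proof.
have c0 : 0 <= sqrt3 by apply: sqrtr_ge0.
have := sqrt3_sqr => c2.
by apply/andP; split; rewrite ltNge; apply/negP => H; nra.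
Qed.

(* The lattice is per1 Z x per2 Z: the matrix with rows (2, sqrt 3) and
   (sqrt 3, 2) preserves it and has the orthogonal eigenvectors (1, 1) and
   (1, -1). The number 1000 only needs to be large. *)
Definition per1 : R := sqrt3 * 1000.

Lemma per1_gt0 : 0 < per1.
Proof. by have /andP[? _] := sqrt3_bounds; rewrite /per1; lra. Qed.

Lemma per1_ge : 1700 < per1.
Proof. by have /andP[? _] := sqrt3_bounds; rewrite /per1; lra. Qed.

Definition per2 : R := 1000.

Lemma per2_gt0 : 0 < per2.
Proof. by rewrite /per2; lra. Qed.

(** No quotient is formed: a point of the torus is a point of the plane up to [wrap], and a map of
    the torus is a map of the plane compatible with [wrap z = wrap w], as the lemmas named [_cong]
    state. *)
Definition wrap z : R * R := (wrap1 per1 z.1, wrap1 per2 z.2).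

Lemma wrap_id z : `|z| < 500 -> wrap z = z.
Proof.
rewrite prod_norm_lt => /and4P[a1 a2 b1 b2]; case: z a1 a2 b1 b2 => x y /=.
move=> *; have p := per1_ge; congr pair.
  apply: (@wrap1_uniq _ _ _ 0); [exact: per1_gt0| |by rewrite mulr0 addr0].
  by apply/andP; split; lra.
apply: (@wrap1_uniq _ _ _ 0); [exact: per2_gt0| |by rewrite mulr0 addr0].
by rewrite /per2; apply/andP; split; lra.
Qed.

Lemma wrapP z w : wrap z = wrap w <->
  exists m n : int, z = w + (per1 * m%:~R, per2 * n%:~R).
Proof.
split=> [[/(wrap1P _ _ per1_gt0)[m em] /(wrap1P _ _ per2_gt0)[n en]]|[m [n ->]]].
  by exists m, n; case: z w em en => [x y] [x' y'] /= -> ->.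
congr pair; first by apply/(wrap1P _ _ per1_gt0); exists m.
by apply/(wrap1P _ _ per2_gt0); exists n.
Qed.

Lemma wrap_ex z : exists m n : int, wrap z = z + (per1 * m%:~R, per2 * n%:~R).
Proof.
have [m em] := wrap1_ex per1 z.1; have [n en] := wrap1_ex 1000 z.2.
by exists m, n; rewrite /wrap em en; case: z {em en}.
Qed.

Lemma wrapK z : wrap (wrap z) = wrap z.
Proof. by apply/wrapP; exact: wrap_ex. Qed.

Lemma wrap_congD z z' w w' :
  wrap z = wrap z' -> wrap w = wrap w' -> wrap (z + w) = wrap (z' + w').
Proof.
move=> /wrapP[m [n ->]] /wrapP[m' [n' ->]]; apply/wrapP.
exists (m + m'), (n + n'); rewrite addrACA; congr (_ + _).
by congr pair => /=; rewrite intrD mulrDr.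
Qed.

Lemma wrap_congN z z' : wrap z = wrap z' -> wrap (- z) = wrap (- z').
Proof.
move=> /wrapP[m [n ->]]; apply/wrapP; exists (- m), (- n); rewrite opprD.
by congr (_ + _); congr pair => /=; rewrite mulrNz mulrN.
Qed.

Lemma wrap_congB z z' w w' :
  wrap z = wrap z' -> wrap w = wrap w' -> wrap (z - w) = wrap (z' - w').
Proof. by move=> zz ww; apply: wrap_congD zz (wrap_congN ww). Qed.

(** By [wrap1_min] this is the distance from z to the lattice for the maximum norm, so that
    [tnorm (z - w)] is the flat distance on the torus. *)
Definition tnorm z : R := `|wrap z|.

Lemma tnorm_le z : tnorm z <= `|z|.
Proof.
rewrite /tnorm !prod_normE ge_max !le_max /=; apply/andP; split; apply/orP.
  by left; have := wrap1_min z.1 0 per1_gt0; rewrite mulr0 addr0.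
by right; have := wrap1_min z.2 0 per2_gt0; rewrite mulr0 addr0.
Qed.

Lemma tnorm0 : tnorm 0 = 0.
Proof.
by apply/eqP; rewrite eq_le normr_ge0 andbT -(normr0 (R * R)%type) tnorm_le.
Qed.

Lemma tnormD z w : tnorm (z + w) <= tnorm z + tnorm w.
Proof.
rewrite /tnorm !prod_normE ge_max /=; apply/andP; split.
  by apply: le_trans (wrap1D_le _ _ per1_gt0) _; apply: lerD; rewrite le_max lexx.
apply: le_trans (wrap1D_le _ _ per2_gt0) _.
by apply: lerD; rewrite le_max lexx orbT.
Qed.

Lemma tnormN z : tnorm (- z) = tnorm z.
Proof.
suff H w : tnorm (- w) <= tnorm w.
  by apply/eqP; rewrite eq_le H -{1}(opprK z) H.
rewrite /tnorm !prod_normE ge_max !le_max /=; apply/andP; split; apply/orP.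
  by left; rewrite wrap1N_le// per1_gt0.
by right; rewrite wrap1N_le// per2_gt0.
Qed.

Lemma tnorm_eq0 z : tnorm z = 0 -> wrap z = 0.
Proof. by move/normr0_eq0. Qed.

Lemma wrapB_eq0 z w : wrap (z - w) = 0 -> wrap z = wrap w.
Proof.
move=> zw; have zw0 : wrap (z - w) = wrap 0.
  by rewrite zw wrap_id// normr0; lra.
by have := wrap_congD zw0 (erefl (wrap w)); rewrite subrK add0r.
Qed.

End Torus.

(** * A planar source with contracting surroundings *)

Section Map.
Context {R : realType}.
Implicit Types (x y a s t u : R) (z w v : R * R).

Definition lam : R := 2 + sqrt3.
Definition ilam : R := 2 - sqrt3.

Lemma lamK : lam * ilam = 1.
Proof. by have := @sqrt3_sqr R; rewrite /lam /ilam => c2; lra. Qed.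

Lemma lam_bounds : 37 / 10 < lam < 38 / 10.
Proof. by have /andP[? ?] := @sqrt3_bounds R; rewrite /lam; lra. Qed.

Lemma ilam_bounds : 2 / 10 < ilam < 3 / 10.
Proof. by have /andP[? ?] := @sqrt3_bounds R; rewrite /ilam; lra. Qed.

(** The linear map multiplies s by [ilam]. Multiplying s by [lam2] beforehand gives it the total
    factor [lam], the same as for u, hence a dilation. *)
Definition lam2 : R := lam * lam.
Definition ilam2 : R := ilam * ilam.

Lemma lam2K : lam2 * ilam2 = 1.
Proof. by rewrite /lam2 /ilam2 mulrACA lamK mulr1. Qed.

Lemma lam2_bounds : 13 < lam2 < 15.
Proof.
by have /andP[? ?] := lam_bounds; rewrite /lam2; apply/andP; split; nra.
Qed.

Lemma lam2_gt0 : 0 < lam2.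
Proof. by have /andP[? _] := lam2_bounds; lra. Qed.

Lemma ilam2_bounds : 0 < ilam2 < 1.
Proof.
by have /andP[? ?] := ilam_bounds; rewrite /ilam2; apply/andP; split; nra.
Qed.

Definition clamp m x : R := Num.max (- m) (Num.min m x).

Lemma clamp_id m x : - m <= x <= m -> clamp m x = x.
Proof. by move=> /andP[? ?]; rewrite /clamp min_r// max_r. Qed.

Lemma clamp_ge m x : 0 <= m -> m <= x -> clamp m x = m.
Proof. by move=> ? ?; rewrite /clamp min_l// max_r//; lra. Qed.

Lemma clampN m x : 0 <= m -> clamp m (- x) = - clamp m x.
Proof.
move=> m0; rewrite /clamp; case: (leP m x) => ?; case: (leP m (- x)) => ?.
all: by repeat case: leP => ?; lra.
Qed.

Lemma clamp_bound m x : 0 <= m -> `|clamp m x| <= m.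
Proof.
move=> m0; rewrite ler_norml /clamp ge_max le_max ge_min !lexx !andbT /=; lra.
Qed.

Lemma clamp0 x : clamp 0 x = 0.
Proof. by apply/eqP; rewrite -normr_le0 clamp_bound. Qed.

(* The map s |-> s + bump a s is odd; for s >= 0 it has slope lam2 up to a,
   then slope 1 / 2 until it meets the diagonal, and is the identity beyond.
   Its inverse is t |-> t + ibump a t. *)
Definition bump a s : R :=
  clamp (Num.max 0 ((lam2 - 1 / 2) * a - `|s| / 2)) ((lam2 - 1) * s).

Definition ibump a t : R :=
  clamp (Num.max 0 ((2 * lam2 - 1) * a - `|t|)) ((ilam2 - 1) * t).

Lemma bumpN a s : bump a (- s) = - bump a s.
Proof. by rewrite /bump normrN mulrN clampN// le_max lexx. Qed.

Lemma ibumpN a s : ibump a (- s) = - ibump a s.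
Proof. by rewrite /ibump normrN mulrN clampN// le_max lexx. Qed.

Lemma bump_small a s : `|s| <= a -> bump a s = (lam2 - 1) * s.
Proof.
move=> sa; have /andP[k1 k2] := lam2_bounds.
wlog s0 : s sa / 0 <= s => [H|].
  have [|/ltW s0] := leP 0 s; first by move=> s0; apply: H.
  by rewrite -[s]opprK bumpN H ?normrN ?oppr_ge0// !mulrN.
rewrite ger0_norm// in sa.
have ka : 13 * (a - s) <= lam2 * (a - s) by rewrite ler_wpM2r ?subr_ge0// ltW.
have ks : 0 <= (lam2 - 1) * s by rewrite mulr_ge0//; lra.
have ks1 : 0 <= (lam2 - 1) * a by rewrite mulr_ge0//; lra.
have m0 : 0 <= (lam2 - 1 / 2) * a - s / 2 by lra.
by rewrite /bump ger0_norm// max_r// clamp_id//; apply/andP; split; lra.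
Qed.

Lemma bump_mid a s : a <= s -> s <= (2 * lam2 - 1) * a ->
  bump a s = (lam2 - 1 / 2) * a - s / 2.
Proof.
move=> sa sb; have /andP[k1 k2] := lam2_bounds.
have a0 : 0 <= a by rewrite leNgt; apply/negP => a0; nra.
have ks : 13 * (s - a) <= lam2 * (s - a) by rewrite ler_wpM2r ?subr_ge0// ltW.
by rewrite /bump ger0_norm ?(le_trans a0)// max_r ?clamp_ge//; lra.
Qed.

Lemma bump_big a s : (2 * lam2 - 1) * a <= `|s| -> bump a s = 0.
Proof.
by move=> sa; rewrite /bump max_l ?clamp0//; lra.
Qed.

Lemma ibump_small a s : 0 <= a -> `|s| <= lam2 * a -> ibump a s = (ilam2 - 1) * s.
Proof.
move=> a0 sa; have /andP[k1 k2] := lam2_bounds; have kk := lam2K.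
have /andP[k3 k4] := ilam2_bounds.
wlog s0 : s sa / 0 <= s => [H|].
  have [|/ltW s0] := leP 0 s; first by move=> s0; apply: H.
  by rewrite -[s]opprK ibumpN H ?normrN ?oppr_ge0// !mulrN.
rewrite ger0_norm// in sa.
have ka : ilam2 * s <= a by rewrite -(ler_pM2l lam2_gt0) mulrA kk mul1r.
have ks : 0 <= ilam2 * s by rewrite mulr_ge0//; lra.
have kt : ilam2 * s <= s by rewrite ler_piMl// ltW.
have l : 13 * a <= lam2 * a by rewrite ler_wpM2r// ltW.
have l2 : lam2 * (ilam2 * s) <= lam2 * a by rewrite ler_pM2l//; lra.
have l3 : lam2 * (ilam2 * s) = s by rewrite mulrA kk mul1r.
have l4 : 13 * (a - ilam2 * s) <= lam2 * (a - ilam2 * s).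
  by rewrite ler_wpM2r ?subr_ge0// ltW.
have m0 : 0 <= (2 * lam2 - 1) * a - s by lra.
by rewrite /ibump ger0_norm// max_r// clamp_id//; apply/andP; split; lra.
Qed.

Lemma ibump_mid a s : 0 <= a -> lam2 * a <= s -> s <= (2 * lam2 - 1) * a ->
  ibump a s = s - (2 * lam2 - 1) * a.
Proof.
move=> a0 sa sb; have /andP[k1 k2] := lam2_bounds; have kk := lam2K.
have /andP[k3 k4] := ilam2_bounds.
have ka : a <= ilam2 * s by rewrite -(ler_pM2l lam2_gt0) mulrA kk mul1r.
have s0 : 0 <= s by rewrite (le_trans _ sa)// mulr_ge0//; lra.
have l3 : lam2 * (ilam2 * s) = s by rewrite mulrA kk mul1r.
have l4 : 13 * (ilam2 * s - a) <= lam2 * (ilam2 * s - a).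
  by rewrite ler_wpM2r ?subr_ge0// ltW.
have kt : ilam2 * s <= s by rewrite ler_piMl// ltW.
rewrite -[RHS]opprK /ibump -[clamp _ _]opprK -clampN ?le_max ?lexx//.
by rewrite ger0_norm// max_r ?clamp_ge//; lra.
Qed.

Lemma ibump_big a s : (2 * lam2 - 1) * a <= `|s| -> ibump a s = 0.
Proof.
by move=> sa; rewrite /ibump max_l ?clamp0//; lra.
Qed.

(** Both displacements are odd, so s >= 0 may be assumed. The intervals with ends 0, a, (2 lam2 - 1)
    a are carried onto those with ends 0, lam2 a, (2 lam2 - 1) a, and on each of them both formulas
    are explicit. *)
Lemma bumpK a s : 0 <= a -> ibump a (s + bump a s) = - bump a s.
Proof.
move=> a0; have /andP[k1 k2] := lam2_bounds; have kk := lam2K.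
wlog s0 : s / 0 <= s => [H|].
  have [|/ltW s0] := leP 0 s; first by move=> s0; apply: H.
  by rewrite -[s]opprK bumpN -opprD ibumpN H ?oppr_ge0.
have [sa|/ltW sa] := leP s a.
  rewrite bump_small ?ger0_norm//.
  have -> : s + (lam2 - 1) * s = lam2 * s by lra.
  have ks : lam2 * s <= lam2 * a by rewrite ler_pM2l//; lra.
  have ks0 : 0 <= lam2 * s by rewrite mulr_ge0//; lra.
  rewrite ibump_small// ?ger0_norm//.
  by rewrite mulrA mulrBl (mulrC ilam2) kk; lra.
have [sb|/ltW sb] := leP s ((2 * lam2 - 1) * a).
  by rewrite bump_mid// ibump_mid//; lra.
by rewrite bump_big ?ger0_norm// addr0 ibump_big ?ger0_norm// oppr0.
Qed.

Lemma ibumpK a s : 0 <= a -> bump a (s + ibump a s) = - ibump a s.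
Proof.
move=> a0; have /andP[k1 k2] := lam2_bounds; have kk := lam2K.
have /andP[k3 k4] := ilam2_bounds.
wlog s0 : s / 0 <= s => [H|].
  have [|/ltW s0] := leP 0 s; first by move=> s0; apply: H.
  by rewrite -[s]opprK ibumpN -opprD bumpN H ?oppr_ge0.
have [sa|/ltW sa] := leP s (lam2 * a).
  rewrite ibump_small ?ger0_norm//.
  have -> : s + (ilam2 - 1) * s = ilam2 * s by lra.
  have ks : ilam2 * s <= a by rewrite -(ler_pM2l lam2_gt0) mulrA kk mul1r.
  have ks0 : 0 <= ilam2 * s by apply: mulr_ge0 => //; apply: ltW.
  rewrite bump_small ?ger0_norm//.
  by rewrite mulrA mulrBl kk; lra.
have [sb|/ltW sb] := leP s ((2 * lam2 - 1) * a).
  by rewrite ibump_mid// bump_mid//; lra.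
by rewrite ibump_big ?ger0_norm// addr0 bump_big ?ger0_norm// oppr0.
Qed.

Lemma bump_bound a s : a <= 10 -> `|bump a s| <= 150.
Proof.
move=> a10; have /andP[k1 k2] := lam2_bounds; have s0 := normr_ge0 s.
have l : (lam2 - 1 / 2) * a <= 145 by nra.
rewrite /bump (le_trans (clamp_bound _ _)) ?le_max ?lexx//.
by rewrite ge_max; apply/andP; split; lra.
Qed.

Lemma ibump_bound a s : 0 <= a <= 10 -> `|ibump a s| <= 300.
Proof.
move=> /andP[a0 a10]; have /andP[k1 k2] := lam2_bounds; have s0 := normr_ge0 s.
have l : (2 * lam2 - 1) * a <= 290 by nra.
rewrite /ibump (le_trans (clamp_bound _ _)) ?le_max ?lexx//.
by rewrite ge_max; apply/andP; split; lra.
Qed.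

(** Beyond a the map s + bump a s has slope 1 / 2 or 1, so it is monotone and does not increase
    distances. *)
Lemma bump_contract a s t : 0 <= a -> a <= s -> a <= t ->
  `|(s - t) + (bump a s - bump a t)| <= `|s - t|.
Proof.
move=> a0; have /andP[k1 k2] := lam2_bounds.
wlog st : s t / t <= s => [H sa ta|sa ta].
  have [|/ltW] := leP t s => ts; first by apply: H.
  have := H _ _ ts ta sa; rewrite -normrN opprD !opprB (addrC (s - t)) -(distrC
    t s).
  by rewrite addrC.
have key : - (s - t) <= bump a s - bump a t <= 0.
  have [sb|/ltW sb] := leP s ((2 * lam2 - 1) * a).
    by rewrite !bump_mid//; lra.
  rewrite (bump_big (s := s)) ?ger0_norm ?(le_trans a0)//.
  have [tb|/ltW tb] := leP t ((2 * lam2 - 1) * a); first by rewrite bump_mid//; lra.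
  by rewrite bump_big ?ger0_norm ?(le_trans a0)//; lra.
by rewrite (ger0_norm (x := s - t)) ?subr_ge0// ler_norml; apply/andP; split; lra.
Qed.

End Map.

(** * The derived-from-Anosov map *)

Section Plane.
Context {R : realType}.
Implicit Types (x y c : R) (z w v : R * R).

(** Unnormalised coordinates along the eigenvectors (1, 1) and (1, -1) of [Amap]; with this scaling
    |u| + |s| is twice the maximum norm. *)
Definition ucoord z : R := z.1 + z.2.
Definition scoord z : R := z.1 - z.2.
Definition svec c : R * R := (c / 2, - (c / 2)).
Definition dilate c z : R * R := (c * z.1, c * z.2).
Definition Amap z : R * R := (2 * z.1 + sqrt3 * z.2, sqrt3 * z.1 + 2 * z.2).
Definition Ainv z : R * R := (2 * z.1 - sqrt3 * z.2, 2 * z.2 - sqrt3 * z.1).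

Lemma sqrt3M x : sqrt3 * (sqrt3 * x) = 3 * x.
Proof. by rewrite mulrA sqrt3_sqr. Qed.

Lemma AmapK z : Ainv (Amap z) = z.
Proof.
by case: z => x y; have := sqrt3M x; have := sqrt3M y => *; congr pair => /=; lra.
Qed.

Lemma AinvK z : Amap (Ainv z) = z.
Proof.
by case: z => x y; have := sqrt3M x; have := sqrt3M y => *; congr pair => /=; lra.
Qed.

Lemma Amap_cong z w : wrap z = wrap w -> wrap (Amap z) = wrap (Amap w).
Proof.
move=> /wrapP[m [n ->]]; apply/wrapP; exists (2 * m + n), (3 * m + 2 * n).
have := sqrt3M m%:~R; case: w => x y e; congr pair => /=;
  rewrite /per1 /per2 !intrD !intrM /=; lra.
Qed.

Lemma Ainv_cong z w : wrap z = wrap w -> wrap (Ainv z) = wrap (Ainv w).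
Proof.
move=> /wrapP[m [n ->]]; apply/wrapP; exists (2 * m - n), (2 * n - 3 * m).
have := sqrt3M m%:~R; case: w => x y e; congr pair => /=;
  rewrite /per1 /per2 !intrB !intrM /=; lra.
Qed.

Lemma AmapB z w : Amap (z - w) = Amap z - Amap w.
Proof. by case: z w => [x y] [x' y']; congr pair => /=; lra. Qed.

Lemma ucoord_Amap z : ucoord (Amap z) = lam * ucoord z.
Proof. by rewrite /ucoord /lam /=; lra. Qed.

Lemma scoord_Amap z : scoord (Amap z) = ilam * scoord z.
Proof. by rewrite /scoord /ilam /=; lra. Qed.

Lemma ucoordD z w : ucoord (z + w) = ucoord z + ucoord w.
Proof. by case: z w => [x y] [x' y']; rewrite /ucoord /=; lra. Qed.

Lemma scoordD z w : scoord (z + w) = scoord z + scoord w.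
Proof. by case: z w => [x y] [x' y']; rewrite /scoord /=; lra. Qed.

Lemma ucoord_svec c : ucoord (svec c) = 0.
Proof. by rewrite /ucoord /=; lra. Qed.

Lemma scoord_svec c : scoord (svec c) = c.
Proof. by rewrite /scoord /=; lra. Qed.

Lemma ucoord_scoord_inj z w : ucoord z = ucoord w -> scoord z = scoord w -> z = w.
Proof.
by case: z w => [x y] [x' y']; rewrite /ucoord /scoord /= => *; congr pair; lra.
Qed.

Lemma ucoord_scoord_norm z : `|ucoord z| + `|scoord z| = 2 * `|z|.
Proof.
case: z => x y; rewrite prod_normE /ucoord /scoord /=.
have [x0|x0] := ger0P x; have [y0|y0] := ger0P y;
  have [u0|u0] := ger0P (x + y); have [s0|s0] := ger0P (x - y);
  case: leP => ?; lra.
Qed.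

Lemma norm_svec c : `|svec c| = `|c| / 2.
Proof.
by have := ucoord_scoord_norm (svec c); rewrite ucoord_svec scoord_svec normr0; lra.
Qed.

Lemma scoord_norm z : `|scoord z| <= 2 * `|z|.
Proof. by have := ucoord_scoord_norm z; have := normr_ge0 (ucoord z); lra. Qed.

Lemma ucoord_norm z : `|ucoord z| <= 2 * `|z|.
Proof. by have := ucoord_scoord_norm z; have := normr_ge0 (scoord z); lra. Qed.

(* Where |u| + |s| <= 10, that is on the ball of radius 5 for the maximum norm,
   adding [beta] to s multiplies it by lam2. *)
Definition beta z : R := bump (Num.max 0 (10 - `|ucoord z|)) (scoord z).
Definition ibeta z : R := ibump (Num.max 0 (10 - `|ucoord z|)) (scoord z).

Lemma rad_bounds x : 0 <= Num.max 0 (10 - `|x|) <= 10.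
Proof.
rewrite le_max lexx ge_max /= ler0n /=.
by have := normr_ge0 x; lra.
Qed.

Lemma norm_beta z : `|beta z| <= 150.
Proof. by have /andP[_ ?] := rad_bounds (ucoord z); exact: bump_bound. Qed.

Lemma norm_ibeta z : `|ibeta z| <= 300.
Proof. exact: ibump_bound (rad_bounds _). Qed.

(** If |u| < 10, the left side is at most 290 while |s| is at least 390; otherwise the left side is
    0. Hence the bump lives well inside the fundamental domain, whose half-widths are at least 500,
    and descends to the torus. *)
Lemma rad_large z : 200 <= `|z| ->
  (2 * lam2 - 1) * Num.max 0 (10 - `|ucoord z|) <= `|scoord z|.
Proof.
move=> z2; have us := ucoord_scoord_norm z; have /andP[k1 k2] := @lam2_bounds R.
have s0 := normr_ge0 (scoord z); have /andP[a0 a1] := rad_bounds (ucoord z).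
case: (leP 0 (10 - `|ucoord z|)) a0 a1 => u0 a0 a1; last by rewrite mulr0.
by nra.
Qed.

Lemma beta_large z : 200 <= `|z| -> beta z = 0.
Proof. by move=> /rad_large H; exact: bump_big. Qed.

Lemma ibeta_large z : 200 <= `|z| -> ibeta z = 0.
Proof. by move=> /rad_large H; exact: ibump_big. Qed.

Lemma wrapD_id z v : `|wrap z| + `|v| < 500 -> wrap (z + v) = wrap z + v.
Proof.
move=> zv; rewrite -[RHS]wrap_id; last exact: le_lt_trans (ler_normD _ _) zv.
by apply: wrap_congD => //; rewrite wrapK.
Qed.

Definition hmap z : R * R := z + svec (beta (wrap z)).
Definition himap z : R * R := z + svec (ibeta (wrap z)).

Lemma svecN c : svec (- c) = - svec c.
Proof. by congr pair => /=; lra. Qed.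

Lemma hmapK z : himap (hmap z) = z.
Proof.
rewrite /himap /hmap; set c := beta (wrap z).
suff -> : ibeta (wrap (z + svec c)) = - c by rewrite svecN addrK.
(* Beyond radius 200 the displacement is 0. Within it, the displacement is too short to leave the
   fundamental domain and it preserves u, which leaves the one-dimensional identity [bumpK]. *)
have [z2|z2] := ltP `|wrap z| 200; last first.
  rewrite /c beta_large// (_ : svec 0 = 0) ?addr0 ?ibeta_large ?oppr0//.
  by congr pair => /=; lra.
have c1 : `|c| <= 150 := norm_beta _.
rewrite wrapD_id ?norm_svec; last by lra.
by rewrite /ibeta ucoordD scoordD ucoord_svec scoord_svec addr0 bumpK// le_max lexx.
Qed.

Lemma himapK z : hmap (himap z) = z.
Proof.
rewrite /himap /hmap; set c := ibeta (wrap z).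
suff -> : beta (wrap (z + svec c)) = - c by rewrite svecN addrK.
have [z2|z2] := ltP `|wrap z| 200; last first.
  rewrite /c ibeta_large// (_ : svec 0 = 0) ?addr0 ?beta_large ?oppr0//.
  by congr pair => /=; lra.
have c1 : `|c| <= 300 := norm_ibeta _.
rewrite wrapD_id ?norm_svec; last by lra.
by rewrite /beta ucoordD scoordD ucoord_svec scoord_svec addr0 ibumpK// le_max lexx.
Qed.

(** * The torus map g and its expansion and contraction *)

Definition gmap z : R * R := Amap (hmap z).
Definition gimap z : R * R := himap (Ainv z).

Lemma gmapK z : gimap (gmap z) = z.
Proof. by rewrite /gimap /gmap AmapK hmapK. Qed.

Lemma gimapK z : gmap (gimap z) = z.
Proof. by rewrite /gimap /gmap himapK AinvK. Qed.

Lemma gmap_cong z w : wrap z = wrap w -> wrap (gmap z) = wrap (gmap w).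
Proof.
by move=> zw; apply: Amap_cong; rewrite /hmap zw; exact: wrap_congD.
Qed.

Lemma gimap_cong z w : wrap z = wrap w -> wrap (gimap z) = wrap (gimap w).
Proof.
by move=> /Ainv_cong zw; rewrite /gimap /himap zw; exact: wrap_congD.
Qed.

Lemma norm_dilate c z : 0 <= c -> `|dilate c z| = c * `|z|.
Proof. by move=> c0; rewrite !prod_normE /= !normrM ger0_norm// maxr_pMr. Qed.

Lemma dilate_lamK z : dilate lam (dilate ilam z) = z.
Proof. by case: z => x y; rewrite /dilate /= !mulrA lamK !mul1r. Qed.

Lemma gmap_small z : `|wrap z| <= 5 -> wrap (gmap z) = dilate lam (wrap z).
Proof.
move=> z5; have /andP[l1 l2] := @lam_bounds R.
rewrite -[RHS]wrap_id; last first.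
  by rewrite norm_dilate; have := normr_ge0 (wrap z); nra.
rewrite -(gmap_cong (wrapK z)) /gmap /hmap wrapK; congr wrap.
have us := ucoord_scoord_norm (wrap z).
have -> : beta (wrap z) = (lam2 - 1) * scoord (wrap z).
  by rewrite /beta bump_small// le_max; apply/orP; right; lra.
have kk : @ilam R * lam2 = lam by rewrite /lam2 mulrA (mulrC ilam) lamK mul1r.
apply: ucoord_scoord_inj; rewrite ?ucoord_Amap ?scoord_Amap ?ucoordD ?scoordD
  ?ucoord_svec ?scoord_svec.
  by rewrite addr0 /ucoord /dilate /=; lra.
by rewrite /scoord /dilate /=; move: kk; set k := lam2; nra.
Qed.

(** By [gmap_small] the contracted point w is sent to the same point of the torus as z, and [gimap]
    makes g injective there. *)
Lemma gmap_small_inv z : `|wrap (gmap z)| <= 5 * lam ->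
  wrap z = dilate ilam (wrap (gmap z)).
Proof.
move=> z5; have /andP[l1 l2] := @lam_bounds R.
have /andP[l3 l4] := @ilam_bounds R; have ll := @lamK R.
set w := dilate ilam _.
have w5 : `|w| <= 5.
  rewrite norm_dilate ?(ltW (lt_trans _ l3))//.
  rewrite (_ : 5 = ilam * (5 * lam)); last by rewrite mulrCA (mulrC ilam) ll mulr1.
  by rewrite ler_wpM2l//; lra.
have ww : wrap w = w by apply: wrap_id; lra.
have := gmap_small (z := w); rewrite ww {2}/w dilate_lamK => /(_ w5) /gimap_cong.
by rewrite !gmapK ww.
Qed.

(** For points at distance at most 1 the difference of the images, computed in the plane, still has
    norm below 500. No lattice translation intervenes, and the eigencoordinates of the difference
    can be followed exactly. *)
Lemma wrap_gmapB z w : `|wrap (z - w)| <= 1 -> wrap (gmap z - gmap w) =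
  Amap (wrap (z - w) + svec (beta (wrap z) - beta (wrap w))).
Proof.
move=> zw; rewrite /gmap -AmapB /hmap opprD addrACA -svecN.
set c := beta _ - beta _.
have -> : svec (beta (wrap z)) + svec (- beta (wrap w)) = svec c.
  by congr pair => /=; rewrite /c; lra.
have c3 : `|c| <= 300.
  by rewrite /c (le_trans (ler_normB _ _))//; have := norm_beta (wrap z);
     have := norm_beta (wrap w); lra.
rewrite -[RHS]wrap_id; first by apply: Amap_cong; apply: wrap_congD; rewrite ?wrapK.
set v := wrap (z - w) in zw *.
have us := ucoord_scoord_norm (Amap (v + svec c)).
rewrite ucoord_Amap scoord_Amap ucoordD scoordD ucoord_svec scoord_svec addr0
  !normrM in us.
have /andP[l1 l2] := @lam_bounds R; have /andP[l3 l4] := @ilam_bounds R.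
rewrite (ger0_norm (x := lam)) ?(ger0_norm (x := ilam)) in us; [|lra..].
have u2 := ucoord_norm v; have s2 := scoord_norm v.
have sc2 : `|scoord v + c| <= 302 by have := ler_normD (scoord v) c; lra.
have := normr_ge0 (ucoord v); have := normr_ge0 (scoord v + c).
by nra.
Qed.

Lemma ucoord_wrap_gmapB z w : `|wrap (z - w)| <= 1 ->
  ucoord (wrap (gmap z - gmap w)) = lam * ucoord (wrap (z - w)).
Proof.
by move=> zw; rewrite wrap_gmapB// ucoord_Amap ucoordD ucoord_svec addr0.
Qed.

Lemma scoord_wrap_gmapB z w : `|wrap (z - w)| <= 1 ->
  scoord (wrap (gmap z - gmap w)) =
  ilam * (scoord (wrap (z - w)) + (beta (wrap z) - beta (wrap w))).
Proof. by move=> zw; rewrite wrap_gmapB// scoord_Amap scoordD scoord_svec. Qed.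

(* Away from the ball where [gmap] is conformal, the two points of a vertical
   pair lie on the same side of it, where [gmap] contracts the s-direction. *)
Lemma gmap_contract z w : 5 * lam < `|wrap z| -> 5 * lam < `|wrap w| ->
  `|wrap (z - w)| <= 1 -> ucoord (wrap (z - w)) = 0 ->
  `|scoord (wrap (gmap z - gmap w))| <= ilam * `|scoord (wrap (z - w))|.
Proof.
move=> z5 w5 zw uzw; rewrite scoord_wrap_gmapB//.
have /andP[l1 l2] := @lam_bounds R; have /andP[l3 l4] := @ilam_bounds R.
rewrite normrM (ger0_norm (x := ilam)) ?(ltW (lt_trans _ l3))//.
rewrite ler_wpM2l ?(ltW (lt_trans _ l3))//.
have e : wrap z = wrap (w + wrap (z - w)).
  rewrite -{1}(subrK w z) addrC; apply: wrap_congD => //.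
  by rewrite wrapK.
set v := wrap (z - w) in zw uzw e *.
(* If w is beyond radius 300, then z, at distance at most 1, is beyond radius 200, and neither point
   feels the bump. *)
have [w3|w3] := leP `|wrap w| 300; last first.
  rewrite (beta_large (z := wrap w)); last by lra.
  rewrite beta_large ?subrr ?addr0// leNgt; apply/negP => z2.
  have ew : wrap w = wrap (z - v).
    by rewrite -(addrK v w); apply: wrap_congB; rewrite ?e.
  rewrite wrapD_id ?normrN in ew; last by lra.
  by have := ler_normB (wrap z) v; rewrite -ew; lra.
rewrite wrapD_id in e; last by lra.
have uz : ucoord (wrap z) = ucoord (wrap w) by rewrite e ucoordD uzw addr0.
have sz : scoord (wrap z) - scoord (wrap w) = scoord v
  by rewrite e scoordD addrC addKr.
rewrite /beta uz; set a := Num.max _ _.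
have nz := ucoord_scoord_norm (wrap z); have nw := ucoord_scoord_norm (wrap w).
have s2 := scoord_norm v; rewrite uz in nz.
have /andP[a0 a1] : 0 <= a <= 10 := rad_bounds _.
rewrite -sz in s2 *; set s := scoord (wrap z) in nz s2 *.
set t := scoord (wrap w) in nw s2 *.
have [u10|u10] := leP 10 `|ucoord (wrap w)|.
  have -> : a = 0 by rewrite /a max_l//; lra.
  by rewrite !bump_big ?mulr0// subrr addr0.
(* Here |u| < 10, whereas |u| + |s| exceeds 10 lam > 37, and likewise for t. So |s| and |t| are at
   least 27, and |s - t| <= 2 forces equal signs. *)
have as1 : a <= `|s| by lra.
have at1 : a <= `|t| by lra.
have s27 : 27 <= `|s| by lra.
have t27 : 27 <= `|t| by lra.
have st2 : `|s - t| <= 2 by lra.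
move: st2; rewrite ler_norml => /andP[st2 st3].
have [s0|s0] := ger0P s; have [t0|t0] := ger0P t.
- by rewrite ger0_norm// in as1; rewrite ger0_norm// in at1; exact: bump_contract.
- by exfalso; rewrite ger0_norm// in s27; rewrite ltr0_norm// in t27; lra.
- by exfalso; rewrite ltr0_norm// in s27; rewrite ger0_norm// in t27; lra.
rewrite ltr0_norm// in as1; rewrite ltr0_norm// in at1.
have := bump_contract a0 at1 as1; rewrite !bumpN.
by rewrite !opprK (addrC (- t)) (addrC (- bump a t)).
Qed.

End Plane.

(** * Continuity on the torus *)

Section PlaneContinuity.
Context {R : realType}.
Implicit Types (c : R) (z w v : R * R).

Lemma continuous_pair (T U V : topologicalType) (f : T -> U) (g : T -> V) :
  continuous f -> continuous g -> continuous (fun x => (f x, g x)).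
Proof. by move=> cf cg x; apply: cvg_pair; [exact: cf|exact: cg]. Qed.

Lemma continuous_maxr (T : topologicalType) (f g : T -> R) :
  continuous f -> continuous g -> continuous (fun x => Num.max (f x) (g x)).
Proof. by move=> cf cg x; apply: continuous_max; [exact: cf|exact: cg]. Qed.

Lemma continuous_minr (T : topologicalType) (f g : T -> R) :
  continuous f -> continuous g -> continuous (fun x => Num.min (f x) (g x)).
Proof. by move=> cf cg x; apply: continuous_min; [exact: cf|exact: cg]. Qed.

Lemma continuous_addr (T : topologicalType) (f g : T -> R) :
  continuous f -> continuous g -> continuous (fun x => f x + g x).
Proof. by move=> cf cg x; apply: cvgD; [exact: cf|exact: cg]. Qed.

Lemma continuous_oppr (T : topologicalType) (f : T -> R) :
  continuous f -> continuous (fun x => - f x).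
Proof. by move=> cf x; apply: cvgN; exact: cf. Qed.

Lemma continuous_mulr (T : topologicalType) (f g : T -> R) :
  continuous f -> continuous g -> continuous (fun x => f x * g x).
Proof. by move=> cf cg x; apply: cvgM; [exact: cf|exact: cg]. Qed.

Lemma continuous_normr (T : topologicalType) (f : T -> R) :
  continuous f -> continuous (fun x => `|f x|).
Proof. by move=> cf x; apply: cvg_norm; exact: cf. Qed.

Lemma continuous_fstr : continuous (fun z => z.1).
Proof. by move=> z; exact: cvg_fst. Qed.

Lemma continuous_sndr : continuous (fun z => z.2).
Proof. by move=> z; exact: cvg_snd. Qed.

Lemma continuous_cstr (T U : topologicalType) (k : U) : continuous (fun _ : T => k).
Proof. by move=> x; exact: cvg_cst. Qed.

Ltac prove_continuous := repeat (first [assumption | lazymatch goal with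
  |- forall x, @continuous_at _ _ x ?f => lazymatch f with
    | (fun p => (_, _)) => apply: continuous_pair
    | (fun p => _ + _) => apply: continuous_addr
    | (fun p => _ * _) => apply: continuous_mulr
    | (fun p => - _) => apply: continuous_oppr
    | (fun p => `|_|) => apply: continuous_normr
    | (fun p => Order.max _ _) => apply: continuous_maxr
    | (fun p => Order.min _ _) => apply: continuous_minr
    | _ => first [exact: continuous_cstr
        | exact: continuous_fstr | exact: continuous_sndr]
    end end]).

Lemma continuous_beta : continuous (@beta R).
Proof. by rewrite /beta /bump /clamp /ucoord /scoord; prove_continuous. Qed.

Lemma continuous_ibeta : continuous (@ibeta R).
Proof. by rewrite /ibeta /ibump /clamp /ucoord /scoord; prove_continuous. Qed.

Lemma near_norm_lt z c : 0 < c -> \forall w \near z, `|w - z| < c.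
Proof.
move=> c0; apply/nbhs_ballP; exists c => //= w.
by rewrite -ball_normE /= distrC.
Qed.

(** [wrap] jumps only at the boundary of the fundamental domain, where F vanishes: near a point of
    wrapped norm below 300 it may be replaced by a translation, and near any other point the
    composite is constantly 0. *)
Lemma continuous_wrap (F : R * R -> R) :
  continuous F -> (forall z, 200 <= `|z| -> F z = 0) ->
  continuous (fun z => F (wrap z)).
Proof.
move=> cF F0 z; have [z3|z3] := ltP `|wrap z| 300.
  have cG : F (wrap z + (w - z)) @[w --> z] --> F (wrap z + (z - z)).
    apply: (@continuous_comp _ _ _ (fun w => wrap z + (w - z)) F).
      by apply: cvgD; [exact: cvg_cst|apply: cvgB; [exact: cvg_id|exact: cvg_cst]].
    exact: cF.
  rewrite subrr addr0 in cG; apply: cvg_trans cG.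
  apply: near_eq_cvg; near=> w.
  rewrite -[in RHS](subrK z w) (addrC (w - z)) wrapD_id//.
  have wz : `|w - z| < 100 by near: w; exact: near_norm_lt.
  by move: z3 wz; clear; lra.
rewrite /continuous_at F0; last by lra.
have c0 : (0 : R) @[_ --> z] --> (0 : R) by exact: cvg_cst.
apply: cvg_trans c0; apply: near_eq_cvg; near=> w.
have wz : `|w - z| < 100 by near: w; exact: near_norm_lt.
rewrite F0// leNgt; apply/negP => w2.
have := tnormD w (z - w); rewrite addrC subrK {1 2}/tnorm.
by have := tnorm_le (z - w); rewrite distrC; move: z3 wz w2; clear; lra.
Unshelve. all: by end_near. Qed.

Lemma continuous_betaw : continuous (fun z : R * R => beta (wrap z)).
Proof. apply: continuous_wrap; [exact: continuous_beta|exact: beta_large]. Qed.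

Lemma continuous_ibetaw : continuous (fun z : R * R => ibeta (wrap z)).
Proof.
apply: continuous_wrap; [exact: continuous_ibeta|exact: ibeta_large].
Qed.

Lemma continuous_gmap : continuous (@gmap R).
Proof.
have cb := continuous_betaw.
suff : continuous (fun z => (2 * (z.1 + beta (wrap z) / 2)
    + sqrt3 * (z.2 + - (beta (wrap z) / 2)),
    sqrt3 * (z.1 + beta (wrap z) / 2)
    + 2 * (z.2 + - (beta (wrap z) / 2)))) by [].
by prove_continuous.
Qed.

Lemma continuous_gimap : continuous (@gimap R).
Proof.
have cA : continuous (@Ainv R) by rewrite /Ainv; prove_continuous.
have cb : continuous (fun z : R * R => ibeta (wrap (Ainv z))).
  move=> z; apply: (@continuous_comp _ _ _ (@Ainv R) (fun z => ibeta (wrap z))).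
    exact: cA.
  exact: continuous_ibetaw.
suff : continuous (fun z => ((2 * z.1 - sqrt3 * z.2) + ibeta (wrap (Ainv z)) / 2,
    (2 * z.2 - sqrt3 * z.1) + - (ibeta (wrap (Ainv z)) / 2))) by [].
by prove_continuous.
Qed.

(** * The inversion, extended to the whole torus *)

Definition sqn v : R := v.1 * v.1 + v.2 * v.2.
Definition tsqn z : R := sqn (wrap z).

Lemma sqn_ge0 v : 0 <= sqn v.
Proof. by rewrite addr_ge0// -expr2 sqr_ge0. Qed.

(** The inversion is governed by the Euclidean norm and the topology by the maximum norm; this
    compares the two. *)
Lemma sqn_norm v : `|v| * `|v| <= sqn v <= 2 * (`|v| * `|v|).
Proof.
rewrite /sqn prod_normE -(normr_id v.1) -(normr_id v.2).
have e (x : R) : x * x = `|x| * `|x| by rewrite -!expr2 real_normK ?num_real.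
rewrite (e v.1) (e v.2) !normr_id.
have sq (s t : R) : 0 <= s -> s <= t -> 0 <= s * s <= t * t.
  by move=> s0 st; rewrite mulr_ge0// ler_pM.
by case: (leP `|v.1| `|v.2|) => [|/ltW] ab;
  have /andP[? ?] := sq _ _ (normr_ge0 _) ab; apply/andP; split; lra.
Qed.

Lemma sqn_dilate c v : sqn (dilate c v) = c * c * sqn v.
Proof. by rewrite /sqn /=; lra. Qed.

(** Although [wrap1] jumps, its absolute value is the distance to the multiples of P, hence
    1-Lipschitz. *)
Lemma continuous_norm_wrap1 (P : R) : 0 < P -> continuous (fun x => `|wrap1 P x|).
Proof.
move=> P0 x; apply/cvgrPdist_lt => e e0; near=> y.
have xy : `|x - y| < e by near: y; exact: cvgr_dist_lt.
apply: le_lt_trans xy; rewrite ler_norml.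
have h1 := wrap1D_le (x - y) y P0; have h2 := wrap1D_le (y - x) x P0.
have := wrap1_min (x - y) 0 P0; have := wrap1_min (y - x) 0 P0.
rewrite !subrK in h1 h2; rewrite !mulr0 !addr0 (distrC y) => *.
by apply/andP; split; lra.
Unshelve. all: by end_near. Qed.

Lemma continuous_tsqn : continuous tsqn.
Proof.
have e : tsqn = fun z => `|wrap1 per1 z.1| * `|wrap1 per1 z.1| +
                      `|wrap1 per2 z.2| * `|wrap1 per2 z.2|.
  by apply/funext => z; rewrite /tsqn /sqn /= -!normrM -!expr2 !ger0_norm ?sqr_ge0.
have c1 : continuous (fun z : R * R => `|wrap1 per1 z.1|).
  move=> z; apply: (@continuous_comp _ _ _ fst (fun x => `|wrap1 per1 x|)).
    exact: cvg_fst.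
  exact: continuous_norm_wrap1 per1_gt0 _.
have c2 : continuous (fun z : R * R => `|wrap1 per2 z.2|).
  move=> z; apply: (@continuous_comp _ _ _ snd (fun x => `|wrap1 per2 x|)).
    exact: cvg_snd.
  exact: continuous_norm_wrap1 per2_gt0 _.
by rewrite e; prove_continuous.
Qed.

(* This is 1 / q for 1 / 16 <= q <= 16, since 1 / 16 + 16 - q is the chord of
   1 / q over that interval, and it vanishes for large q. *)
Definition invcut (q : R) : R :=
  Num.max 0 (Num.min (Num.max q (1 / 16))^-1 (1 / 16 + 16 - q)).

Lemma invcut_inv q : 1 / 16 <= q <= 16 -> invcut q = q^-1.
Proof.
move=> /andP[q1 q2]; have q0 : 0 < q by lra.
have qi : q * q^-1 = 1 by rewrite divff ?gt_eqF.
have qi0 : 0 < q^-1 by rewrite invr_gt0.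
have qc : q^-1 <= 1 / 16 + 16 - q.
  rewrite -(ler_pM2l q0) qi.
  by have : 0 <= (q - 1 / 16) * (16 - q); [apply: mulr_ge0; lra|lra].
by rewrite /invcut (max_l q1) min_l// max_r// ltW.
Qed.

Lemma invcut_zero q : 17 <= q -> invcut q = 0.
Proof. by move=> q1; rewrite /invcut max_l// ge_min; apply/orP; right; lra. Qed.

Lemma invcut_ge0 q : 0 <= invcut q.
Proof. by rewrite /invcut le_max lexx. Qed.

Lemma invcut_le q : 1 / 16 <= q -> invcut q <= q^-1.
Proof.
move=> q1; rewrite /invcut (max_l q1) ge_max invr_ge0 ge_min lexx andbT; lra.
Qed.

Lemma invcut_le16 q : invcut q <= 16.
Proof.
have m0 : 0 < Num.max q (1 / 16) by rewrite lt_max; apply/orP; right; lra.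
rewrite /invcut ge_max ge_min; apply/andP; split; first by lra.
apply/orP; left; rewrite -[leRHS]invrK lef_pV2 ?posrE ?invr_gt0//.
by rewrite le_max; apply/orP; right; lra.
Qed.

Lemma continuous_invcut : continuous invcut.
Proof.
have cid : continuous (fun q : R => q) by move=> q; exact: cvg_id.
have cm : continuous (fun q : R => Num.max q (1 / 16)) by prove_continuous.
have ci : continuous (fun q : R => (Num.max q (1 / 16))^-1).
  move=> q; apply: cvgV.
    by rewrite gt_eqF// lt_max; apply/orP; right; lra.
  exact: cm.
have side : continuous (fun q : R => - q) by exact: continuous_oppr.
by rewrite /invcut; prove_continuous.
Qed.

(** The gluing inversion z / |z|^2 on the annulus 1 / 4 <= |z| <= 4, cut off so that it is
    continuous on the whole torus and equal to 0 far from the origin. *)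
Definition tau z : R * R := dilate (invcut (tsqn z)) (wrap z).

Lemma continuous_tau : continuous tau.
Proof.
have cs : continuous sqn by rewrite /sqn; prove_continuous.
have ck : continuous (fun v => invcut (sqn v)).
  move=> v; apply: (@continuous_comp _ _ _ sqn invcut); first exact: cs.
  exact: continuous_invcut.
have k0 v : 200 <= `|v| -> invcut (sqn v) = 0.
  move=> v2; apply: invcut_zero; have /andP[q1 _] := sqn_norm v.
  by have := normr_ge0 v; nra.
apply: continuous_pair.
- apply: (@continuous_wrap (fun v => invcut (sqn v) * v.1));
  first by prove_continuous.
  by move=> v /k0 ->; rewrite mul0r.
- apply: (@continuous_wrap (fun v => invcut (sqn v) * v.2));
  first by prove_continuous.
  by move=> v /k0 ->; rewrite mul0r.
Qed.

End PlaneContinuity.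

(** * Inversion and reflection *)

Section Inversion.
Context {R : realType}.
Implicit Types (c q : R) (z w v : R * R).

Lemma tsqn_cong z w : wrap z = wrap w -> tsqn z = tsqn w.
Proof. by rewrite /tsqn => ->. Qed.

Lemma tau_cong z w : wrap z = wrap w -> tau z = tau w.
Proof. by rewrite /tau /tsqn => ->. Qed.

Lemma tsqn_ge0 z : 0 <= tsqn z.
Proof. exact: sqn_ge0. Qed.

Lemma tsqn_norm z : `|wrap z| * `|wrap z| <= tsqn z <= 2 * (`|wrap z| * `|wrap z|).
Proof. exact: sqn_norm. Qed.

Lemma tsqn_norm_le z c : 0 <= c -> tsqn z <= c * c -> `|wrap z| <= c.
Proof.
move=> c0 qc; rewrite leNgt; apply/negP => cz.
by have /andP[? _] := tsqn_norm z; nra.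
Qed.

Lemma tsqn_norm_ge z c : 0 <= c -> c <= `|wrap z| -> c * c <= tsqn z.
Proof. by move=> c0 cz; have /andP[? _] := tsqn_norm z; nra. Qed.

Lemma norm_tau z : `|tau z| <= 100.
Proof.
have k0 := invcut_ge0 (tsqn z); have k16 := invcut_le16 (tsqn z).
rewrite norm_dilate//; have z0 := normr_ge0 (wrap z).
have [z5|/ltW z5] := leP `|wrap z| 5; first by nra.
have q17 := tsqn_norm_ge (ler0n R 5) z5.
by rewrite invcut_zero ?mul0r//; lra.
Qed.

Lemma wrap_tau z : wrap (tau z) = tau z.
Proof. by apply: wrap_id; have := norm_tau z; lra. Qed.

Lemma tsqn_tau z : tsqn (tau z) = invcut (tsqn z) * invcut (tsqn z) * tsqn z.
Proof. by rewrite {1}/tsqn wrap_tau sqn_dilate. Qed.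

Lemma tau_inv z : 1 / 16 <= tsqn z <= 16 -> tau z = dilate (tsqn z)^-1 (wrap z).
Proof. by move=> qz; rewrite /tau invcut_inv. Qed.

Lemma tsqn_tau_inv z : 1 / 16 <= tsqn z <= 16 -> tsqn (tau z) = (tsqn z)^-1.
Proof.
move=> qz; rewrite tsqn_tau invcut_inv// -mulrA mulVf ?mulr1//.
by rewrite gt_eqF//; move: qz => /andP[]; lra.
Qed.

Lemma inv_range q : 1 / 16 <= q <= 16 -> 1 / 16 <= q^-1 <= 16.
Proof.
move=> /andP[q1 q2]; have q0 : 0 < q by lra.
by rewrite -(div1r q) ler_pdivlMr// ler_pdivrMr//; apply/andP; split; lra.
Qed.

Lemma tauK z : 1 / 16 <= tsqn z <= 16 -> tau (tau z) = wrap z.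
Proof.
move=> qz; have q0 : tsqn z != 0 by rewrite gt_eqF//; move: qz => /andP[]; lra.
rewrite tau_inv ?tsqn_tau_inv ?inv_range// wrap_tau tau_inv// invrK.
by case: (wrap z) => x y; rewrite /dilate /= !mulVKf.
Qed.

Lemma tsqn_tau_le z : 1 / 16 <= tsqn z -> tsqn (tau z) * tsqn z <= 1.
Proof.
move=> qz; have q0 : 0 < tsqn z by lra.
have k1 : invcut (tsqn z) * tsqn z <= 1 by rewrite -ler_pdivlMr// div1r invcut_le.
have k0 : 0 <= invcut (tsqn z) * tsqn z by rewrite mulr_ge0 ?invcut_ge0// ltW.
by rewrite tsqn_tau; nra.
Qed.

(** This reflection exchanges u and s, preserves the lattice and commutes with the inversion. *)
Definition Jmap z : R * R := (z.1, - z.2).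

Lemma JmapK z : Jmap (Jmap z) = z.
Proof. by case: z => x y; rewrite /Jmap /= opprK. Qed.

Lemma norm_Jmap z : `|Jmap z| = `|z|.
Proof. by rewrite !prod_normE /= normrN. Qed.

Lemma JmapB z w : Jmap (z - w) = Jmap z - Jmap w.
Proof. by case: z w => [x y] [x' y']; congr pair => /=; lra. Qed.

Lemma ucoord_Jmap z : ucoord (Jmap z) = scoord z.
Proof. by rewrite /ucoord /scoord. Qed.

Lemma Jmap_cong z w : wrap z = wrap w -> wrap (Jmap z) = wrap (Jmap w).
Proof.
move=> /wrapP[m [n ->]]; apply/wrapP; exists m, (- n).
by case: w => x y; congr pair; rewrite /= mulrNz; lra.
Qed.

Lemma wrap_Jmap z : `|wrap z| < 500 -> wrap (Jmap z) = Jmap (wrap z).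
Proof. by move=> z5; rewrite -(Jmap_cong (wrapK z)) wrap_id// norm_Jmap. Qed.

Lemma tnorm_Jmap z : tnorm (Jmap z) = tnorm z.
Proof.
suff H w : tnorm (Jmap w) <= tnorm w.
  by apply/eqP; rewrite eq_le H -{1}(JmapK z) H.
rewrite /tnorm -(Jmap_cong (wrapK w)); apply: le_trans (tnorm_le _) _.
by rewrite norm_Jmap.
Qed.

Lemma tsqn_Jmap z : tsqn (Jmap z) = tsqn z.
Proof.
have e : `|wrap1 per2 (- z.2)| = `|wrap1 per2 z.2|.
  apply/eqP; rewrite eq_le wrap1N_le ?per2_gt0//=.
  by rewrite -[in leLHS](opprK z.2) wrap1N_le// per2_gt0.
rewrite /tsqn /sqn /=; congr (_ + _).
by rewrite -!expr2 -[LHS]real_normK ?num_real// e real_normK ?num_real.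
Qed.

Lemma tau_Jmap z : tau (Jmap z) = Jmap (tau z).
Proof.
rewrite /tau tsqn_Jmap; have [z5|/ltW z5] := leP `|wrap z| 5.
  rewrite wrap_Jmap; last by lra.
  by rewrite /dilate /Jmap /= mulrN.
have q17 := tsqn_norm_ge (ler0n R 5) z5.
rewrite invcut_zero; last by lra.
by rewrite /dilate /Jmap /= !mul0r oppr0.
Qed.

(** The ball of radius 5 lam is covered exactly by dilation of the ball of radius 5. This
    alternative controls [tsqn] along orbits without any study of g outside that ball. *)
Lemma gmap_dich z :
  wrap (gmap z) = dilate lam (wrap z) \/ 5 * lam < `|wrap (gmap z)|.
Proof.
have [g5|g5] := leP `|wrap (gmap z)| (5 * lam); [left|by right].
by rewrite (gmap_small_inv g5) dilate_lamK.
Qed.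

Lemma tsqn_gmap_dilate z : wrap (gmap z) = dilate lam (wrap z) ->
  tsqn (gmap z) = lam2 * tsqn z.
Proof. by rewrite /tsqn => ->; rewrite sqn_dilate. Qed.

Lemma tsqn_gmap_large z : 5 * lam < `|wrap z| -> 300 < tsqn z.
Proof.
have /andP[l1 _] := @lam_bounds R => z5.
have l5 : 0 <= 5 * lam :> R by lra.
by have := tsqn_norm_ge l5 (ltW z5); nra.
Qed.

Definition jgimap z : R * R := Jmap (gimap (Jmap z)).

Lemma jgimap_cong z w : wrap z = wrap w -> wrap (jgimap z) = wrap (jgimap w).
Proof. by move=> /Jmap_cong/gimap_cong/Jmap_cong. Qed.

Lemma continuous_jgimap : continuous jgimap.
Proof.
have cJ : continuous (Jmap : R * R -> R * R).
  apply: continuous_pair; first exact: continuous_fstr.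
  exact: continuous_oppr (@continuous_sndr R).
have c1 : continuous (gimap \o Jmap : R * R -> R * R).
  by move=> z; apply: continuous_comp; [exact: cJ|exact: continuous_gimap].
by move=> z; apply: (@continuous_comp _ _ _ (gimap \o Jmap)); [exact: c1|exact: cJ].
Qed.

End Inversion.

(** * The surface of genus two *)

(* The first component runs over the torus carrying the attractor, the second
   over the one carrying the repeller; each point is determined by the component
   that lies outside the unit disc. *)
Definition on_surface (R : realType) (p : (R * R) * (R * R)) : Prop :=
  [/\ wrap p.1 = p.1, wrap p.2 = p.2 &
      (1 <= tsqn p.1 /\ p.2 = tau p.1) \/ (1 <= tsqn p.2 /\ p.1 = tau p.2)].

Record surface (R : realType) :=
  Surface { pt : (R * R) * (R * R) ; ptP : on_surface pt }.

HB.instance Definition _ (R : realType) := gen_eqMixin (surface R).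
HB.instance Definition _ (R : realType) := gen_choiceMixin (surface R).

Section SurfaceMetric.
Context {R : realType}.
Implicit Types (p q : surface R) (c : bool).

Definition side c p : R * R := if c then (pt p).1 else (pt p).2.

Lemma side_inj c p q : side c p = side c q ->
  side (~~ c) p = side (~~ c) q -> p = q.
Proof.
case: p q => [[a b] ha] [[a' b'] hb] e1 e2.
have [ea eb] : a = a' /\ b = b' by case: c e1 e2.
by subst; rewrite (Prop_irrelevance ha hb).
Qed.

Lemma wrap_side c p : wrap (side c p) = side c p.
Proof. by have [? ? _] := ptP p; case: c. Qed.

Lemma side_tau c p : (1 <= tsqn (side c p) /\ side (~~ c) p = tau (side c p)) \/
  (1 <= tsqn (side (~~ c) p) /\ side c p = tau (side (~~ c) p)).
Proof. by have [_ _ [] ?] := ptP p; case: c; [left|right|right|left]. Qed.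

(** The surface sits in the product of the two tori, and this is the induced maximum metric; no
    topology has to be glued by hand. *)
Definition pdist p q : R := Num.max (tnorm (side true p - side true q))
  (tnorm (side false p - side false q)).

Lemma pdist_le c p q (e : R) : tnorm (side c p - side c q) <= e ->
  tnorm (side (~~ c) p - side (~~ c) q) <= e -> pdist p q <= e.
Proof. by case: c => ? ?; rewrite /pdist ge_max; apply/andP. Qed.

Lemma tnorm_side_le c p q : tnorm (side c p - side c q) <= pdist p q.
Proof. by rewrite /pdist le_max; case: c; rewrite lexx ?orbT. Qed.

Lemma pdistxx p : pdist p p = 0.
Proof. by rewrite /pdist !subrr tnorm0 maxxx. Qed.

Lemma pdist_positivity p q : pdist p q = 0 -> p = q.
Proof.
move=> d0; have H c : side c p = side c q.
  rewrite -(wrap_side c p) -(wrap_side c q); apply: wrapB_eq0; apply: tnorm_eq0.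
  by apply/eqP; rewrite eq_le normr_ge0 -d0 tnorm_side_le.
exact: (@side_inj true).
Qed.

Lemma pdist_sym p q : pdist p q = pdist q p.
Proof. by rewrite /pdist -tnormN opprB -(tnormN (_ - side false q)) opprB. Qed.

Lemma pdist_triangle q p r : pdist p r <= pdist p q + pdist q r.
Proof.
have H c : tnorm (side c p - side c r) <= pdist p q + pdist q r.
  rewrite -(subrKA (side c q)) (le_trans (tnormD _ _))//.
  exact: lerD (tnorm_side_le _ _ _) (tnorm_side_le _ _ _).
exact: (@pdist_le true).
Qed.

End SurfaceMetric.

Arguments side : simpl never.

HB.instance Definition _ (R : realType) := isMetric.Build R (surface R)
  (@pdistxx R) (@pdist_positivity R) (@pdist_sym R) (@pdist_triangle R).

Section SurfaceMaps.
Context {R : realType}.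
Implicit Types (p q : surface R) (c : bool) (z w : R * R).

(** The condition stands under the existential so that choice yields a total parametrisation
    [spoint c], with arbitrary values where tsqn z < 1 / 16. Where tsqn z < 1 the roles of the two
    components are exchanged, since [tau] is an involution on the annulus. *)
Lemma spoint_exists c z : exists p,
  1 / 16 <= tsqn z -> side c p = wrap z /\ side (~~ c) p = tau z.
Proof.
have H w : 1 / 16 <= tsqn w -> exists p, side c p = wrap w /\ side (~~ c) p = tau w.
  move=> qw; have H : (1 <= tsqn (wrap w) /\ tau w = tau (wrap w)) \/
      (1 <= tsqn (tau w) /\ wrap w = tau (tau w)).
    rewrite (tau_cong (wrapK w)) (tsqn_cong (wrapK w)).
    have [q1|/ltW q1] := leP 1 (tsqn w); [by left|right].
    have qw2 : 1 / 16 <= tsqn w <= 16 by apply/andP; split; lra.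
    rewrite tauK// tsqn_tau_inv//; split=> //.
    by rewrite -(div1r (tsqn w)) ler_pdivlMr; lra.
  case: c.
    suff h : on_surface (wrap w, tau w) by exists (Surface h).
    by split; rewrite /= ?wrapK ?wrap_tau.
  suff h : on_surface (tau w, wrap w) by exists (Surface h).
  by split; rewrite /= ?wrapK ?wrap_tau//; case: H; [right|left].
have [/H[p hp]|qz] := leP (1 / 16) (tsqn z); first by exists p.
have [|p _] := H (1, 0).
  by rewrite /tsqn wrap_id ?prod_norm_lt /sqn /=; [lra|apply/and4P; split; lra].
by exists p => ?; exfalso; lra.
Qed.

Definition spoint c z : surface R := sval (cid (spoint_exists c z)).

Lemma spoint_side c z : 1 / 16 <= tsqn z -> side c (spoint c z) = wrap z.
Proof. by move=> qz; rewrite /spoint; case: cid => p /= /(_ qz)[]. Qed.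

Lemma spoint_sideN c z : 1 / 16 <= tsqn z -> side (~~ c) (spoint c z) = tau z.
Proof. by move=> qz; rewrite /spoint; case: cid => p /= /(_ qz)[]. Qed.

Lemma spointN_side c z : 1 / 16 <= tsqn z -> side c (spoint (~~ c) z) = tau z.
Proof. by move=> qz; have := @spoint_sideN (~~ c) z qz; rewrite negbK. Qed.

Lemma spoint_cong c z w : wrap z = wrap w -> 1 / 16 <= tsqn z ->
  spoint c z = spoint c w.
Proof.
move=> zw qz; have qw : 1 / 16 <= tsqn w by rewrite -(tsqn_cong zw).
by apply: (@side_inj _ c); rewrite ?spoint_side ?spoint_sideN// (tau_cong zw).
Qed.

Lemma spoint_sideK c p : 1 / 16 <= tsqn (side c p) -> spoint c (side c p) = p.
Proof.
move=> qz; apply: (@side_inj _ c); rewrite ?spoint_side ?spoint_sideN ?wrap_side//.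
have [[]//|[qc e]] := side_tau c p.
have q16 : tsqn (side (~~ c) p) <= 16.
  by have := @tsqn_tau_le _ (side (~~ c) p); rewrite -e; nra.
by rewrite e tauK ?wrap_side//; apply/andP; split; lra.
Qed.

Lemma tsqn_side_ge c p (e : R) : 1 <= e <= 16 -> tsqn (side (~~ c) p) <= e ->
  e^-1 <= tsqn (side c p).
Proof.
move=> /andP[e1 e2] qe; have e0 : 0 < e by lra.
have [[q1 _]|[q1 ->]] := side_tau c p.
  by apply: le_trans q1; rewrite invf_le1.
rewrite tsqn_tau_inv; last by apply/andP; split; lra.
by rewrite lef_pV2// posrE; lra.
Qed.

Lemma tsqn_side_gt16 c p : tsqn (side (~~ c) p) <= 16 -> 1 / 16 <= tsqn (side c p).
Proof.
by move=> q16; rewrite div1r; apply: tsqn_side_ge q16; apply/andP; split; lra.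
Qed.

Lemma tsqn_side_le c p : 1 / 16 <= tsqn (side c p) ->
  tsqn (side (~~ c) p) * tsqn (side c p) <= 1.
Proof.
by move=> qc; rewrite -{1}(spoint_sideK qc) spoint_sideN// tsqn_tau_le.
Qed.

(** This is the change of charts on the gluing annulus. *)
Lemma spoint_flip c z : 1 / 16 <= tsqn z <= 16 ->
  spoint c z = spoint (~~ c) (tau z).
Proof.
move=> qz; have /andP[q1 q2] := qz.
have /andP[q3 q4] : 1 / 16 <= tsqn (tau z) <= 16
  by rewrite tsqn_tau_inv// inv_range.
apply: (@side_inj _ c); first by rewrite spoint_side// spointN_side// tauK.
by rewrite spoint_sideN// spoint_side// wrap_tau.
Qed.

Lemma flip_exists p : exists q, forall c, side c q = wrap (Jmap (side (~~ c) p)).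
Proof.
suff h : on_surface (wrap (Jmap (side false p)), wrap (Jmap (side true p))).
  by exists (Surface h) => -[].
have e z : tau (wrap (Jmap z)) = wrap (Jmap (tau z)).
  by rewrite (tau_cong (wrapK _)) -tau_Jmap wrap_tau.
split; rewrite /= ?wrapK//.
have /= [[q1 ->]|[q1 ->]] := side_tau true p; [right|left];
  by rewrite (tsqn_cong (wrapK _)) tsqn_Jmap e.
Qed.

(** An isometric involution exchanging the two tori. By [smapK] it conjugates [smap] to its inverse,
    so results on the future yield results on the past. *)
Definition flip p : surface R := sval (cid (flip_exists p)).

Lemma side_flip c p : side c (flip p) = wrap (Jmap (side (~~ c) p)).
Proof. by rewrite /flip; case: cid. Qed.

Lemma tsqn_side_flip c p : tsqn (side c (flip p)) = tsqn (side (~~ c) p).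
Proof. by rewrite side_flip (tsqn_cong (wrapK _)) tsqn_Jmap. Qed.

Lemma flip_spoint c z : 1 / 16 <= tsqn z ->
  flip (spoint c z) = spoint (~~ c) (Jmap z).
Proof.
move=> qz; apply: (@side_inj _ c); rewrite side_flip.
  rewrite spoint_sideN// spointN_side ?tsqn_Jmap//.
  by rewrite -tau_Jmap wrap_tau.
by rewrite negbK spoint_side// spoint_side ?tsqn_Jmap// (Jmap_cong (wrapK z)).
Qed.

Lemma flipK p : flip (flip p) = p.
Proof.
by apply: (@side_inj _ true); rewrite side_flip side_flip (Jmap_cong (wrapK _))
  JmapK wrap_side.
Qed.

Lemma pdist_flip p q : pdist (flip p) (flip q) = pdist p q.
Proof.
rewrite /pdist maxC !side_flip; have e z w :
    tnorm (wrap (Jmap z) - wrap (Jmap w)) = tnorm (z - w).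
  rewrite -[RHS]tnorm_Jmap JmapB /tnorm; congr `|_|.
  by apply: wrap_congB; rewrite wrapK.
by rewrite !e.
Qed.

(** * The map of the surface and its inverse *)

Lemma jgimap_small z : `|wrap z| <= 5 * lam ->
  wrap (jgimap z) = dilate ilam (wrap z).
Proof.
move=> z5; have /andP[l1 l2] := @lam_bounds R.
have /andP[l3 l4] := @ilam_bounds R.
set w := dilate ilam (wrap z); have w5 : `|w| <= 5.
  rewrite norm_dilate ?(ltW (lt_trans _ l3))//.
  rewrite (_ : 5 = ilam * (5 * lam)).
    by rewrite ler_wpM2l//; lra.
  by rewrite mulrCA (mulrC ilam) lamK mulr1.
have ww : wrap w = w by apply: wrap_id; lra.
have wJ : wrap (Jmap w) = Jmap w by rewrite wrap_Jmap ww//; lra.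
have := gmap_small (z := Jmap w); rewrite wJ norm_Jmap => /(_ w5) e.
have e2 : wrap (gmap (Jmap w)) = wrap (Jmap z).
  rewrite e -(Jmap_cong (wrapK z)) wrap_Jmap ?wrapK; last by lra.
  by rewrite /w /dilate /Jmap /= mulrN !mulrA lamK !mul1r.
have := Jmap_cong (gimap_cong e2); rewrite gmapK JmapK ww => ->.
by rewrite /jgimap.
Qed.

(** The first formula makes sense as long as the second component has tsqn at most 16, the second
    one keeps the image outside the unit disc as soon as tsqn is at least [lam2]; since lam2 < 16
    the two ranges overlap. *)
Definition smap p : surface R :=
  if tsqn (side false p) <= lam2 then spoint true (gmap (side true p))
  else spoint false (jgimap (side false p)).

Arguments smap : simpl never.

Lemma dilateM (a b : R) z : dilate a (dilate b z) = dilate (a * b) z.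
Proof. by rewrite /dilate /= !mulrA. Qed.

Lemma tsqn_gmap_ge z : 1 / 16 <= tsqn z -> 1 / 16 <= tsqn (gmap z).
Proof.
move=> qz; have [/tsqn_gmap_dilate ->|/tsqn_gmap_large ?] := gmap_dich z;
  last by lra.
by have /andP[k1 _] := @lam2_bounds R; nra.
Qed.

(** On the overlap, between [lam2] and 16, the two formulas agree: there g is the dilation by [lam],
    [jgimap] the dilation by [ilam], and the inversion conjugates one to the other. *)
Lemma smap_in p : tsqn (side false p) <= 16 ->
  smap p = spoint true (gmap (side true p)).
Proof.
move=> q16; rewrite /smap; case: leP => // qk.
have /andP[k1 k2] := @lam2_bounds R; have kk := @lam2K R.
have /andP[l1 l2] := @lam_bounds R; have /andP[l3 l4] := @ilam_bounds R.
set b := side false p in q16 qk *; set a := side true p.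
have bw : wrap b = b := wrap_side _ _.
have qb : 1 / 16 <= tsqn b <= 16 by apply/andP; split; lra.
have /= [[q1 e]|[_ e]] := side_tau true p; rewrite -/a -/b in e *.
  exfalso; rewrite -/a in q1; have qa : 1 / 16 <= tsqn a by lra.
  by have := tsqn_tau_le qa; rewrite -e; nra.
have b5 : `|wrap b| <= 5 * lam.
  by apply: (@tsqn_norm_le _ _ _ _); nra.
have jb := jgimap_small b5; rewrite bw in jb.
have qjb : tsqn (jgimap b) = ilam2 * tsqn b by rewrite /tsqn jb sqn_dilate bw.
have qj : 1 / 16 <= tsqn (jgimap b) <= 16.
  by rewrite qjb; have /andP[i1 i2] := @ilam2_bounds R; apply/andP; split; nra.
rewrite spoint_flip//; symmetry; apply: spoint_cong; last first.
  by apply: tsqn_gmap_ge; apply: tsqn_side_gt16.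
have qa : tsqn a = (tsqn b)^-1 by rewrite e tsqn_tau_inv.
have a5 : `|wrap a| <= 5.
  apply: tsqn_norm_le => //; rewrite qa.
  by have /andP[_ ?] := inv_range qb; lra.
rewrite gmap_small// wrap_tau tau_inv//
  qjb jb -/a (wrap_side true p : wrap a = a) e tau_inv// bw !dilateM.
congr (dilate _ _); rewrite invfM.
have i0 : ilam2 != 0 :> R by have /andP[i1 _] := @ilam2_bounds R; rewrite gt_eqF.
have -> : ilam2^-1 = lam2 :> R by apply: (mulIf i0); rewrite mulVf// kk.
by rewrite mulrAC /lam2 -(mulrA lam) lamK mulr1.
Qed.

Lemma smap_out p : lam2 < tsqn (side false p) ->
  smap p = spoint false (jgimap (side false p)).
Proof. by rewrite /smap; case: leP. Qed.

(** Up to reflection w is the image of z. Either g dilates at w, and tsqn w is tsqn z / lam2, or g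
    sends w beyond radius 5 lam, which cannot happen from the unit disc. *)
Lemma tsqn_jgimap_ge z : lam2 <= tsqn z -> 1 <= tsqn (jgimap z).
Proof.
move=> qz; rewrite /jgimap tsqn_Jmap; set w := gimap _.
have : tsqn (gmap w) = tsqn z by rewrite /w gimapK tsqn_Jmap.
have [/tsqn_gmap_dilate ->|w5 qw] := gmap_dich w.
  by move=> e; rewrite -(ler_pM2l lam2_gt0) mulr1 e.
rewrite leNgt; apply/negP => q1.
have w1 : `|wrap w| <= 1 by apply: tsqn_norm_le => //; lra.
have e : wrap (gmap w) = dilate lam (wrap w) by apply: gmap_small; lra.
have /andP[l1 l2] := @lam_bounds R.
by rewrite e norm_dilate in w5; nra.
Qed.

(** Three cases: p lies beyond the neck on the second torus, or its image lies beyond the neck on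
    the first one, or both are in the neck. In the first two g and its inverse cancel on one torus;
    in the third all maps are dilations and inversions. *)
Lemma smapK p : flip (smap (flip (smap p))) = p.
Proof.
have /andP[k1 k2] := @lam2_bounds R.
have /andP[l1 l2] := @lam_bounds R.
have [qb|qb] := leP (tsqn (side false p)) lam2; last first.
  set b := side false p in qb *; rewrite (smap_out qb) -/b.
  have qj := tsqn_jgimap_ge (ltW qb).
  have qj16 : 1 / 16 <= tsqn (jgimap b) by lra.
  have qJ : 1 / 16 <= tsqn (Jmap (jgimap b)) by rewrite tsqn_Jmap.
  rewrite flip_spoint//= smap_in; last first.
    rewrite (spoint_sideN true qJ : side false _ = _); have := tsqn_tau_le qJ.
    by have := tsqn_ge0 (tau (Jmap (jgimap b))); nra.
  rewrite spoint_side//.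
  have e : wrap (gmap (wrap (Jmap (jgimap b)))) = wrap (Jmap b).
    by rewrite (gmap_cong (wrapK _)) /jgimap JmapK gimapK.
  have qb16 : 1 / 16 <= tsqn b by lra.
  have qJb : 1 / 16 <= tsqn (Jmap b) by rewrite tsqn_Jmap.
  have qe : 1 / 16 <= tsqn (gmap (wrap (Jmap (jgimap b)))) by rewrite (tsqn_cong e).
  by rewrite (spoint_cong _ e)// flip_spoint// JmapK spoint_sideK.
set a := side true p.
have aw : wrap a = a := wrap_side _ _.
have qak : lam2^-1 <= tsqn a by apply: (@tsqn_side_ge true p) => //;
  apply/andP; split; lra.
have qa : 1 / 16 <= tsqn a by apply: (@tsqn_side_gt16 true p) => /=; lra.
have pE : spoint true a = p by exact: spoint_sideK.
have qg : 1 <= tsqn (gmap a).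
  have [/tsqn_gmap_dilate ->|/tsqn_gmap_large] := gmap_dich a; last by lra.
  by rewrite -(ler_pM2l lam2_gt0) divff ?gt_eqF ?lam2_gt0// in qak.
have qg16 : 1 / 16 <= tsqn (gmap a) by lra.
rewrite (smap_in (p := p)) -/a; last by lra.
rewrite flip_spoint//=.
have [qgk|qgk] := leP (tsqn (gmap a)) lam2; last first.
  have qJg : 1 / 16 <= tsqn (Jmap (gmap a)) by rewrite tsqn_Jmap.
  rewrite smap_out ?spoint_side// ?(tsqn_cong (wrapK _)) ?tsqn_Jmap//.
  have e : wrap (jgimap (wrap (Jmap (gmap a)))) = wrap (Jmap a).
    by rewrite (jgimap_cong (wrapK _)) /jgimap JmapK gmapK.
  have qJa : 1 / 16 <= tsqn (Jmap a) by rewrite tsqn_Jmap.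
  have qe : 1 / 16 <= tsqn (jgimap (wrap (Jmap (gmap a)))) by rewrite (tsqn_cong e).
  by rewrite (spoint_cong _ e)// flip_spoint// JmapK.
rewrite smap_in; last by rewrite spoint_side ?tsqn_Jmap//
  (tsqn_cong (wrapK _)) tsqn_Jmap; lra.
have qJg : 1 / 16 <= tsqn (Jmap (gmap a)) by rewrite tsqn_Jmap.
rewrite (spoint_sideN false qJg : side true _ = _) tau_Jmap.
have ga : wrap (gmap a) = dilate lam a.
  have [->|/tsqn_gmap_large] := gmap_dich a; first by rewrite aw.
  by move=> ?; exfalso; lra.
have qga : tsqn (gmap a) = lam2 * tsqn a by apply: tsqn_gmap_dilate; rewrite ga aw.
have qa16 : 1 / 16 <= tsqn a <= 16.
  by apply/andP; split=> //; move: qgk; rewrite qga; nra.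
have qgr : 1 / 16 <= tsqn (gmap a) <= 16 by apply/andP; split; lra.
set t := tau (gmap a).
have qt : tsqn t = (tsqn (gmap a))^-1 by exact: tsqn_tau_inv.
have tw : wrap t = t by exact: wrap_tau.
have t5 : `|wrap (Jmap t)| <= 5.
  apply: tsqn_norm_le => //; rewrite tsqn_Jmap qt.
  by have /andP[_ ?] := inv_range qgr; lra.
have t5' : `|wrap t| <= 5 by rewrite -/(tnorm t) -tnorm_Jmap.
have e : wrap (gmap (Jmap t)) = wrap (Jmap (tau a)).
  rewrite gmap_small// wrap_Jmap ?tw; last by rewrite -tw; lra.
  rewrite wrap_Jmap; last by rewrite wrap_tau; have := norm_tau a; lra.
  rewrite wrap_tau /t tau_inv// tau_inv// ga aw qga !dilateM.
  rewrite invfM mulrAC (_ : lam2^-1 * lam = lam^-1); last first.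
    by rewrite /lam2 invfM -mulrA mulVf ?mulr1// gt_eqF//; lra.
  have ll : lam * lam^-1 = 1 :> R by rewrite divff// gt_eqF//; lra.
  by rewrite /dilate /Jmap /= mulrN !mulrA ll !mul1r.
have qt2 := tsqn_tau_inv qa16; have /andP[qi1 _] := inv_range qa16.
have qJt : 1 / 16 <= tsqn (Jmap (tau a)) by rewrite tsqn_Jmap qt2.
have qe : 1 / 16 <= tsqn (gmap (Jmap t)) by rewrite (tsqn_cong e).
by rewrite (spoint_cong _ e)// flip_spoint// JmapK -(spoint_flip true).
Qed.

Definition simap p : surface R := flip (smap (flip p)).

Lemma smap_simap : cancel smap simap.
Proof. by move=> p; exact: smapK. Qed.

Lemma simap_smap : cancel simap smap.
Proof. by move=> p; rewrite -[LHS]flipK /simap smapK flipK. Qed.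

End SurfaceMaps.

(** * Topology of the surface *)

Section Topology.
Context {R : realType}.
Implicit Types (p q : surface R) (c : bool) (z w : R * R).

Lemma mdistE p q : mdist p q = pdist p q.
Proof. by []. Qed.

Lemma pdist_lt c p q (e : R) : tnorm (side c p - side c q) < e ->
  tnorm (side (~~ c) p - side (~~ c) q) < e -> pdist p q < e.
Proof. by case: c => ? ?; rewrite /pdist gt_max; apply/andP. Qed.

Lemma tnorm_wrapB z w : tnorm (wrap z - wrap w) = tnorm (z - w).
Proof. by congr `|_|; apply: wrap_congB; rewrite wrapK. Qed.

Lemma nearP_norm z (P : set (R * R)) : (\forall w \near z, P w) ->
  exists2 e : R, 0 < e & forall w, `|z - w| < e -> P w.
Proof.
move=> /nbhs_ballP[e /= e0 h]; exists e => // w zw.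
by apply: h; rewrite -ball_normE.
Qed.

Lemma near_tsqn_gt z (q : R) : q < tsqn z -> \forall w \near z, q < tsqn w.
Proof.
by move=> qz; exact: (cvgr_gt _ (@continuous_tsqn R z) q qz).
Qed.

Lemma near_tsqn_lt z (q : R) : tsqn z < q -> \forall w \near z, tsqn w < q.
Proof.
by move=> qz; exact: (cvgr_lt _ (@continuous_tsqn R z) q qz).
Qed.

(** [side c] is continuous only into the torus, as its value may jump by a lattice vector; hence a
    representative z close to [side c p] is used in place of [side c q]. *)
Lemma near_side c p (P : set (R * R)) : (\forall z \near side c p, P z) ->
  \forall q \near p, exists2 z, wrap z = side c q & P z.
Proof.
move=> /nearP_norm[e e0 h]; apply/nbhs_ballP; exists e => //= q.
rewrite ballEmdist /= mdistE => pq.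
exists (side c p - wrap (side c p - side c q)).
  by rewrite (wrap_congB (erefl _) (wrapK _)) subKr wrap_side.
apply: h; rewrite opprB addrC subrK.
exact: le_lt_trans (tnorm_side_le c p q) pq.
Qed.

Lemma near_mdistP (f : surface R -> surface R) p : {for p, continuous f} <->
  forall e : R, 0 < e -> \forall q \near p, mdist (f p) (f q) < e.
Proof. exact: (@metricType_numDomainType.cvgrPdist_lt _ _ _ (nbhs p)). Qed.

Lemma near_normP (f : surface R -> R * R) p : {for p, continuous f} <->
  forall e : R, 0 < e -> \forall q \near p, `|f p - f q| < e.
Proof. exact: (@cvgrPdist_lt _ _ _ (nbhs p) (nbhs_filter p)). Qed.

Lemma near_eq_continuous (f g : surface R -> surface R) p :
  (\forall q \near p, f q = g q) -> {for p, continuous g} -> {for p, continuous f}.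
Proof.
move=> fg /near_mdistP cg; have fgp := nbhs_singleton fg.
apply/near_mdistP => e /cg ge.
by apply: filterS2 fg ge => q; rewrite fgp => ->.
Qed.

Lemma spoint_continuous c z : 1 / 16 < tsqn z -> {for z, continuous (spoint c)}.
Proof.
move=> qz; apply/metricType_numDomainType.cvgrPdist_lt => e e0.
near=> w; rewrite mdistE.
have qw : 1 / 16 < tsqn w by near: w; exact: near_tsqn_gt.
have [qz' qw'] : 1 / 16 <= tsqn z /\ 1 / 16 <= tsqn w by split; exact: ltW.
have zw : `|w - z| < e by near: w; exact: near_norm_lt.
have tzw : `|tau z - tau w| < e.
  by near: w; exact: (cvgr_dist_lt (@tau R) (tau z) (@continuous_tau R z) e e0).
apply: (@pdist_lt c).
  by rewrite !spoint_side// tnorm_wrapB (le_lt_trans (tnorm_le _))// distrC.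
by rewrite !spoint_sideN// (le_lt_trans (tnorm_le _)).
Unshelve. all: by end_near. Qed.

Lemma spoint_side_continuous c c' (F : R * R -> R * R) p :
  continuous F -> (forall z w, wrap z = wrap w -> wrap (F z) = wrap (F w)) ->
  1 / 16 < tsqn (F (side c p)) ->
  {for p, continuous (fun q => spoint c' (F (side c q)))}.
Proof.
move=> cF Fw qF; apply/near_mdistP => e e0.
have cm : {for side c p, continuous (spoint c' \o F)}.
  by apply: continuous_comp; [exact: cF|exact: spoint_continuous].
have qn : \forall z \near side c p, 1 / 16 < tsqn (F z).
  exact: (cF (side c p) _ (near_tsqn_gt qF)).
have /near_side h : \forall z \near side c p, 1 / 16 < tsqn (F z) /\
    mdist (spoint c' (F (side c p))) (spoint c' (F z)) < e.
  near=> z; split; first by near: z.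
  near: z; exact: (metricType_numDomainType.cvgr_dist_lt cm).
apply: filterS h => q [z zq [qz zd]].
have zF : wrap (F z) = wrap (F (side c q)) by apply: Fw; rewrite zq wrap_side.
by rewrite -(spoint_cong c' zF)// ltW.
Unshelve. all: by end_near. Qed.

(** The two formulas hold on the open sets where tsqn of the second component is below 16 and above
    [lam2], and these cover the surface. *)
Lemma smap_continuous : continuous (@smap R).
Proof.
move=> p; have [q15|q15] := ltP (tsqn (side false p)) 16.
  have eq : \forall q \near p, smap q = spoint true (gmap (side true q)).
    apply: filterS (near_side (near_tsqn_lt q15)) => q [z zq qz].
    by apply: smap_in; rewrite -zq (tsqn_cong (wrapK z)) ltW.
  have h : {for p, continuous (fun q => spoint true (gmap (side true q)))}.
    apply: spoint_side_continuous; [exact: continuous_gmap|exact: gmap_cong|].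
    have q16 : 1 / 16 <= tsqn (side true p) by apply: tsqn_side_gt16; exact: ltW.
    have [/tsqn_gmap_dilate ->|/tsqn_gmap_large] := gmap_dich (side true p);
      last by lra.
    by have /andP[? ?] := @lam2_bounds R; nra.
  exact: near_eq_continuous eq h.
have qk : lam2 < tsqn (side false p) by have /andP[? ?] := @lam2_bounds R; lra.
have eq : \forall q \near p, smap q = spoint false (jgimap (side false q)).
  apply: filterS (near_side (near_tsqn_gt qk)) => q [z zq qz].
  by apply: smap_out; rewrite -zq (tsqn_cong (wrapK z)).
have h : {for p, continuous (fun q => spoint false (jgimap (side false q)))}.
  apply: spoint_side_continuous; [exact: continuous_jgimap|exact: jgimap_cong|].
  by have := tsqn_jgimap_ge (ltW qk); lra.
exact: near_eq_continuous eq h.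
Qed.

Lemma flip_continuous : continuous (@flip R).
Proof.
move=> p; apply/near_mdistP => e e0.
apply/nbhs_ballP; exists e => //= q; rewrite ballEmdist /= !mdistE.
by rewrite pdist_flip.
Qed.

Lemma simap_continuous : continuous (@simap R).
Proof.
move=> p; rewrite /simap.
apply: (@continuous_comp _ _ _ (smap \o flip) flip); last exact: flip_continuous.
by apply: continuous_comp; [exact: flip_continuous|exact: smap_continuous].
Qed.

Definition shomeo : homeomorphism (surface R) (surface R) :=
  Homeomorphism (@smap_simap R) (@simap_smap R) smap_continuous simap_continuous.

(** * Compactness and connectedness *)

Lemma connected_setX (U V : topologicalType) (A : set U) (B : set V) :
  connected A -> connected B -> connected (A `*` B).
Proof.
move=> cA cB; have [->|/set0P[a Aa]] := eqVneq A set0.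
  by rewrite set0X; exact: connected0.
(* The product is a union of crosses that share the slice over a. *)
have -> : A `*` B = \bigcup_(b in B) ((A `*` [set b]) `|` ([set a] `*` B)).
  apply/seteqP; split=> [[x y] [/= Ax By]|[x y] [b Bb] [] [/= h1 h2]].
  - by exists y => //; left.
  - by rewrite h2.
  - by rewrite h1.
have [->|/set0P[b0 Bb0]] := eqVneq B set0.
  by rewrite bigcup_set0; exact: connected0.
apply: bigcup_connected.
  by exists (a, b0) => b Bb; right.
move=> b Bb; apply: connectedU.
- by exists (a, b); split.
- have -> : A `*` [set b] = (fun x => (x, b)) @` A.
    apply/seteqP; split=> [[x y] [/= Ax ->]|_ [x Ax <-]//].
    by exists x.
  apply: connected_continuous_connected => //.
  apply: continuous_subspaceT => x.
  by apply: cvg_pair; [exact: cvg_id|exact: cvg_cst].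
- have -> : [set a] `*` B = (fun y => (a, y)) @` B.
    apply/seteqP; split=> [[x y] [/= -> By]|_ [y By <-]//].
    by exists y.
  apply: connected_continuous_connected => //.
  apply: continuous_subspaceT => x.
  by apply: cvg_pair; [exact: cvg_cst|exact: cvg_id].
Qed.

(* Together the two strips cover the torus minus a disc, once reduced modulo
   the lattice. *)
Definition strip (b : bool) : set (R * R) :=
  if b then `[1 / 3, per1 - 1 / 3] `*` `[0, per2]
  else `[0, per1] `*` `[1 / 3, per2 - 1 / 3].

Lemma strip_compact b : compact (strip b).
Proof. by case: b; apply: compact_setX; exact: segment_compact. Qed.

Lemma strip_connected b : connected (strip b).
Proof. by case: b; apply: connected_setX; exact: segment_connected. Qed.

Lemma wrap1_large (P x : R) : 0 < P -> 1 / 3 <= x <= P - 1 / 3 ->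
  1 / 9 <= wrap1 P x * wrap1 P x.
Proof.
move=> P0 /andP[x1 x2]; have [m ->] := wrap1_ex P x.
have [m0|m0] := leP 0 m.
  have m1 : 0 <= P * m%:~R by rewrite mulr_ge0 ?ler0z// ltW.
  by nra.
have m1 : m%:~R <= -1 :> R by rewrite -(mulrN1z 1) ler_int -ltzD1.
have : P * m%:~R <= P * -1 by rewrite ler_pM2l.
by nra.
Qed.

Lemma strip_tsqn b z : strip b z -> 1 / 16 < tsqn z.
Proof.
have s (x : R) : 0 <= x * x by rewrite -expr2 sqr_ge0.
rewrite /tsqn /sqn /wrap /=; case: b => -[] /=; rewrite !in_itv /= => h1 h2.
  have := wrap1_large per1_gt0 h1; have := s (wrap1 per2 z.2); lra.
have := wrap1_large per2_gt0 h2; have := s (wrap1 per1 z.1); lra.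
Qed.

Lemma strip_cover p : exists c b, (spoint c @` strip b) p.
Proof.
have [c qc] : exists c, 1 <= tsqn (side c p).
  by have [[]|[]] := side_tau true p => ? _; [exists true|exists false].
exists c; set z := side c p in qc *.
have zw : wrap z = z by exact: wrap_side.
(* Moving coordinates to [0, P] puts the removed disc at the corners. The bound 1 / 3 works since
   two coordinates below it give tsqn < 2 / 9 < 1, while one coordinate above it gives tsqn >= 1 / 9
   > 1 / 16. *)
have shift (P x : R) : 0 < P -> wrap1 P x = x -> exists m : int,
    0 <= x + P * m%:~R <= P /\
    (1 / 3 <= `|x| -> P >= 1 -> 1 / 3 <= x + P * m%:~R <= P - 1 / 3).
  move=> P0 wx; have := wrap1_bounds x P0; rewrite wx => /andP[x1 x2].
  have [x0|x0] := leP 0 x.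
    exists 0; rewrite mulr0 addr0; split; first by apply/andP; split; lra.
    by rewrite ger0_norm// => ? ?; apply/andP; split; lra.
  exists 1; rewrite mulr1; split; first by apply/andP; split; lra.
  by rewrite ltr0_norm// => ? ?; apply/andP; split; lra.
have [e1 e2] : wrap1 per1 z.1 = z.1 /\ wrap1 per2 z.2 = z.2 by rewrite -{2 4}zw.
have [m [m1 m2]] := shift _ _ per1_gt0 e1.
have [n [n1 n2]] := shift _ _ per2_gt0 e2.
have p1 : 1 <= per1 :> R by have := @per1_ge R; lra.
have p2 : 1 <= per2 :> R by rewrite /per2; lra.
pose w := z + (per1 * m%:~R, per2 * n%:~R).
have wz : wrap w = wrap z by apply/wrapP; exists m, n.
have mw : spoint c w = p.
  by rewrite (spoint_cong c wz) ?spoint_sideK// ?(tsqn_cong wz) -/z; lra.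
have [z1|z1] := leP (1 / 3) `|z.1|.
  by exists true, w => //; split; rewrite /= in_itv /=; [exact: m2|exact: n1].
exists false, w => //; split; rewrite /= in_itv /=; first exact: m1.
apply: n2 => //; rewrite leNgt; apply/negP => z2.
move: qc; rewrite /tsqn /sqn zw; move: z1 z2; rewrite !ltr_norml.
by move=> /andP[? ?] /andP[? ?]; nra.
Qed.

Lemma spoint_strip_continuous c b : {within strip b, continuous (spoint c)}.
Proof.
apply: continuous_in_subspaceT => z /set_mem /strip_tsqn; exact: spoint_continuous.
Qed.

Lemma surfaceE : [set: surface R] =
  (spoint true @` strip true `|` spoint true @` strip false) `|`
  (spoint false @` strip true `|` spoint false @` strip false).
Proof.
apply/seteqP; split=> // p _; have [[] [[] h]] := strip_cover p.
- by left; left.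
- by left; right.
- by right; left.
- by right; right.
Qed.

Lemma surface_compact : compact [set: surface R].
Proof.
have h c b : compact (spoint c @` strip b).
  apply: continuous_compact; [exact: spoint_strip_continuous|exact: strip_compact].
by rewrite surfaceE; apply: compactU; apply: compactU; exact: h.
Qed.

Lemma wrap_unit : wrap (1, 0) = (1, 0) :> R * R.
Proof. by rewrite wrap_id// prod_norm_lt /=; apply/and4P; split; lra. Qed.

Lemma tsqn_unit : tsqn (1, 0) = 1 :> R.
Proof. by rewrite /tsqn wrap_unit /sqn /=; lra. Qed.

(** The inversion fixes (1, 0); this common point links the two halves of the surface. *)
Lemma spoint_unit : spoint true (1, 0) = spoint false (1, 0) :> surface R.
Proof.
have q : 1 / 16 <= tsqn (1, 0 : R) <= 16 by rewrite tsqn_unit; apply/andP;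
  split; lra.
rewrite spoint_flip//= tau_inv// tsqn_unit wrap_unit; congr (spoint _ _).
by congr pair; rewrite /= ?mulr0// invr1 mulr1.
Qed.

Lemma surface_connected : connected [set: surface R].
Proof.
have h c b : connected (spoint c @` strip b).
  apply: connected_continuous_connected; first exact: strip_connected.
  exact: spoint_strip_continuous.
have p1 := @per1_ge R.
have hc c : connected (spoint c @` strip true `|` spoint c @` strip false).
  apply: connectedU => //; exists (spoint c (1, 1)).
  split; exists (1, 1) => //; split; rewrite /= in_itv /per2 /=;
    by apply/andP; split; rewrite ?divr_ge0//; lra.
have u : strip true (1, 0).
  by split; rewrite /= in_itv /per2 /=; apply/andP; split;
    rewrite ?lexx ?ler0n//; lra.
rewrite surfaceE; apply: connectedU => //; exists (spoint true (1, 0)); split; left.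
  by exists (1, 0).
by exists (1, 0) => //; rewrite spoint_unit.
Qed.

(** * Planar charts *)

Lemma surface_planar : locally_planar R (surface R).
Proof.
move=> p; have [c qc] : exists c, 1 <= tsqn (side c p).
  by have [[]|[]] := side_tau true p => ? _; [exists true|exists false].
have [e e0 eQ] : exists2 e : R, 0 < e & forall w, `|side c p - w| < e ->
  1 / 16 < tsqn w.
  have q16 : 1 / 16 < tsqn (side c p) by lra.
  exact: nearP_norm (near_tsqn_gt q16).
(* The bound e keeps the disc where [spoint c] is meaningful, and the bound 1 prevents wrapping
   around the torus. *)
pose r := Num.min e 1; have r0 : 0 < r by rewrite lt_min e0 ltr01.
have re : r <= e by rewrite ge_min lexx.
have r1 : r <= 1 by rewrite ge_min lexx orbT.
set z := side c p in qc eQ.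
pose U := [set q : surface R | tnorm (z - side c q) < r].
(* The chart picks the representative of [side c q] closest to z. *)
pose phi (q : surface R) := z - wrap (z - side c q).
have phi_cong q : wrap (phi q) = side c q.
  by rewrite /phi (wrap_congB (erefl _) (wrapK _)) subKr wrap_side.
have phi_ball q : U q -> `|z - phi q| < r by rewrite /phi subKr.
exists U, (ball z r), phi, (spoint c); split.
- rewrite openE => q /= Uq; apply/nbhs_ballP.
  exists (r - tnorm (z - side c q)); first by rewrite /= subr_gt0.
  move=> q'; rewrite ballEmdist /= mdistE => qq'.
  have := tnormD (z - side c q) (side c q - side c q'); rewrite subrKA.
  have := tnorm_side_le c q q'; rewrite /U /=; lra.
- by rewrite /U /= subrr tnorm0.
- exact: ball_open.
split.
- apply: continuous_in_subspaceT => q /set_mem Uq.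
  apply/near_normP => d d0; apply/nbhs_ballP; exists (Num.min d 1).
    by rewrite /= lt_min d0 ltr01.
  move=> q' /=; rewrite ballEmdist /= mdistE lt_min => /andP[qd q1].
  have tq := tnorm_side_le c q q'.
  suff -> : phi q' = phi q - wrap (side c q - side c q').
    by rewrite subKr; exact: le_lt_trans tq qd.
  have e1 : wrap (z - side c q') = wrap (z - side c q) + wrap (side c q - side
    c q').
    rewrite -wrapD_id; last by move: Uq tq; rewrite /U /tnorm /=; lra.
    by rewrite -(subrKA (side c q)); apply: wrap_congD; rewrite ?wrapK.
  by rewrite /phi e1 opprD addrA.
- apply: continuous_in_subspaceT => w /set_mem zw; apply: spoint_continuous.
  apply: eQ; move: zw; rewrite -ball_normE /= => zw; exact: lt_le_trans zw re.
- move=> q Uq; have pq := phi_ball q Uq.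
  split; first by rewrite -ball_normE.
  have qp : 1 / 16 < tsqn (phi q) by apply: eQ; exact: lt_le_trans pq re.
  have pc : wrap (phi q) = wrap (side c q) by rewrite phi_cong wrap_side.
  by rewrite (spoint_cong c pc) ?ltW// spoint_sideK// -(tsqn_cong pc) ltW.
- move=> w; rewrite -ball_normE /= => zw.
  have qw : 1 / 16 < tsqn w by apply: eQ; exact: lt_le_trans zw re.
  rewrite /U /phi /= spoint_side ?ltW//.
  have e1 : wrap (z - wrap w) = wrap (z - w).
    by apply: wrap_congB => //; rewrite wrapK.
  split; first by rewrite /tnorm e1 (le_lt_trans (tnorm_le _)).
  by rewrite e1 wrap_id ?subKr//; lra.
Qed.

Lemma surface_closed : compact_boundaryless_surface (surface R).
Proof.
split; [exact: surface_compact|exact: surface_connected|exact: surface_planar].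
Qed.

End Topology.

(** * Close orbits *)

Section Dynamics.
Context {R : realType}.
Implicit Types (p q : surface R) (e : R).

Lemma lam_expr_ge (n : nat) : n%:R <= lam ^+ n :> R.
Proof.
have /andP[l1 l2] := @lam_bounds R.
suff : n%:R + 1 <= lam ^+ n :> R by lra.
elim: n => [|n IH]; first by rewrite expr0 add0r.
by rewrite exprS -natr1; have := ler0n R n; nra.
Qed.

Lemma lam_bounded (x C : R) : (forall n : nat, x * lam ^+ n <= C) -> x <= 0.
Proof.
move=> h; rewrite leNgt; apply/negP => x0.
have := truncnS_gt (C / x); rewrite ltr_pdivrMr// mulrC ltNge => /negP; apply.
by apply: le_trans (h (Num.truncn (C / x)).+1); rewrite ler_pM2l// lam_expr_ge.
Qed.

(** A forward invariant region on which [smap] acts as g on the first component. *)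
Definition inner p := tsqn (side false p) <= 16.

Lemma inner_tsqn p : inner p -> 1 / 16 <= tsqn (side true p).
Proof. exact: (@tsqn_side_gt16 _ true p). Qed.

Lemma side_smap p : inner p -> side true (smap p) = wrap (gmap (side true p)).
Proof.
by move=> ip; rewrite smap_in// spoint_side// tsqn_gmap_ge// inner_tsqn.
Qed.

Lemma inner_smap p : inner p -> inner (smap p).
Proof.
move=> ip; have qg := tsqn_gmap_ge (inner_tsqn ip).
rewrite /inner smap_in// (spoint_sideN true qg : side false _ = _).
by have := tsqn_tau_le qg; have := tsqn_ge0 (tau (gmap (side true p))); nra.
Qed.

Lemma inner_iter p n : inner p -> inner (iter n smap p).
Proof. by move=> ip; elim: n => //= n; exact: inner_smap. Qed.

Definition sdiff p q : R * R := wrap (side true p - side true q).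

Lemma sdiff_smap p q : inner p -> inner q ->
  sdiff (smap p) (smap q) = wrap (gmap (side true p) - gmap (side true q)).
Proof.
by move=> ip iq; rewrite /sdiff !side_smap//; apply: wrap_congB; rewrite wrapK.
Qed.

Lemma norm_sdiff p q : `|sdiff p q| <= pdist p q.
Proof. exact: (tnorm_side_le true). Qed.

Lemma ucoord_sdiff_smap p q : inner p -> inner q -> pdist p q <= 1 ->
  ucoord (sdiff (smap p) (smap q)) = lam * ucoord (sdiff p q).
Proof.
move=> ip iq pq; rewrite sdiff_smap// ucoord_wrap_gmapB//.
exact: le_trans (norm_sdiff p q) pq.
Qed.

Definition fclose e p q := forall n : nat,
  pdist (iter n smap p) (iter n smap q) <= e.

Lemma fclose_ucoord e p q : e <= 1 -> inner p -> inner q -> fclose e p q ->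
  ucoord (sdiff p q) = 0.
Proof.
move=> e1 ip iq pq; have /andP[l1 l2] := @lam_bounds R.
have pq1 n : pdist (iter n smap p) (iter n smap q) <= 1 := le_trans (pq n) e1.
apply/eqP; rewrite -normr_le0; apply: (@lam_bounded _ 2) => n.
have -> : `|ucoord (sdiff p q)| * lam ^+ n =
          `|ucoord (sdiff (iter n smap p) (iter n smap q))|.
  elim: n => [|n IH]; first by rewrite expr0 mulr1.
  rewrite exprSr mulrA IH /= ucoord_sdiff_smap//; try exact: inner_iter.
  by rewrite normrM (ger0_norm (x := lam)) 1?mulrC//; lra.
by have := ucoord_norm (sdiff (iter n smap p) (iter n smap q));
   have := norm_sdiff (iter n smap p) (iter n smap q); have := pq1 n; lra.
Qed.

(** By [gmap_small_inv], a point of the ball of radius 5 lam comes from that same ball by dilation,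
    so an orbit found there at time n was dilated at every earlier step. *)
Lemma norm_side_iter n p : inner p -> `|side true (iter n smap p)| <= 5 * lam ->
  `|side true p| * lam ^+ n = `|side true (iter n smap p)|.
Proof.
move=> ip; have /andP[l1 l2] := @lam_bounds R.
have /andP[l3 l4] := @ilam_bounds R; have ll := @lamK R.
elim: n => [|n IH]; first by rewrite expr0 mulr1.
rewrite iterS; set y := iter n smap p in IH *.
rewrite side_smap; last exact: inner_iter.
move=> y5; have := gmap_small_inv y5; rewrite wrap_side => e.
have ny : `|side true y| = ilam * `|wrap (gmap (side true y))|.
  by rewrite {1}e norm_dilate//; lra.
have y5' : `|side true y| <= 5 * lam.
  by have := normr_ge0 (wrap (gmap (side true y))); nra.
by rewrite exprSr mulrA IH// ny mulrAC (mulrC ilam) ll mul1r.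
Qed.

Lemma sdiff_eq0 p q : inner p -> inner q -> sdiff p q = 0 -> p = q.
Proof.
move=> ip iq /wrapB_eq0; rewrite !wrap_side => pq.
by rewrite -(spoint_sideK (inner_tsqn ip)) -(spoint_sideK (inner_tsqn iq)) pq.
Qed.

(** * Orbits that stay close in the past and in the future *)

Definition bclose e p q := fclose e p q /\
  forall n : nat, pdist (iter n simap p) (iter n simap q) <= e.

Lemma bclose_simap e p q : bclose e p q -> bclose e (simap p) (simap q).
Proof.
move=> [f b]; split=> n; last by rewrite -!iterSr.
case: n => [|n]; first exact: (b 1%N).
by rewrite !iterSr !simap_smap.
Qed.

Lemma bclose_smap e p q : bclose e p q -> bclose e (smap p) (smap q).
Proof.
move=> [f b]; split=> n; first by rewrite -!iterSr.
case: n => [|n]; first exact: (f 1%N).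
by rewrite !iterSr !smap_simap.
Qed.

Lemma bclose_iter_simap e p q n : bclose e p q ->
  bclose e (iter n simap p) (iter n simap q).
Proof. by move=> pq; elim: n => //= n; exact: bclose_simap. Qed.

Lemma bclose_iter_smap e p q n : bclose e p q ->
  bclose e (iter n smap p) (iter n smap q).
Proof. by move=> pq; elim: n => //= n; exact: bclose_smap. Qed.

Lemma iter_simap p n : iter n simap p = flip (iter n smap (flip p)).
Proof. by elim: n => [|n IH] /=; rewrite ?flipK// IH /simap flipK. Qed.

Lemma iter_smap_flip p n : iter n smap (flip p) = flip (iter n simap p).
Proof. by rewrite iter_simap flipK. Qed.

Lemma iter_simap_flip p n : iter n simap (flip p) = flip (iter n smap p).
Proof. by rewrite iter_simap flipK. Qed.

Lemma bclose_flip e p q : bclose e p q -> bclose e (flip p) (flip q).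
Proof.
move=> [f b]; split=> n; first by rewrite !iter_smap_flip pdist_flip.
by rewrite !iter_simap_flip pdist_flip.
Qed.

Lemma bcloseE e p q : fclose e p q -> fclose e (flip p) (flip q) -> bclose e p q.
Proof. by move=> f b; split=> // n; rewrite !iter_simap pdist_flip. Qed.

Lemma iter_simapK n p : iter n smap (iter n simap p) = p.
Proof. by elim: n => // n IH; rewrite iterSr iterS simap_smap. Qed.

Lemma iter_smapK n p : iter n simap (iter n smap p) = p.
Proof. by elim: n => // n IH; rewrite iterSr iterS smap_simap. Qed.

(** By [inner_smap] the future is then inner as well: the whole orbit stays on the first torus. *)
Definition attracted p := forall n : nat, inner (iter n simap p).

Lemma attracted_simap p : attracted p -> attracted (simap p).
Proof. by move=> ap n; rewrite -iterSr. Qed.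

Lemma attracted_inner p : attracted p -> inner p.
Proof. by move=> /(_ 0%N). Qed.

Lemma attracted_norm p : attracted p -> 5 * lam < `|side true p|.
Proof.
move=> ap; rewrite ltNge; apply/negP => p5.
(* Otherwise the n-th preimage would have norm at most 5 lam / lam^n. But inner points have tsqn >=
   1 / 16, hence maximum norm at least the root of 1 / 32, which exceeds 1 / 6. *)
suff : 1 / 6 <= 0 :> R by lra.
apply: (@lam_bounded _ (5 * lam)) => n.
have := @norm_side_iter n (iter n simap p) (ap n).
rewrite iter_simapK => /(_ p5) e; apply: le_trans p5; rewrite -e.
rewrite ler_wpM2r ?exprn_ge0//; first by have /andP[? _] := @lam_bounds R; lra.
have /andP[_] := tsqn_norm (side true (iter n simap p)); rewrite wrap_side.
have := inner_tsqn (ap n); have := normr_ge0 (side true (iter n simap p)).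
by move=> n0 q1 q2; rewrite leNgt; apply/negP => n6; nra.
Qed.

Lemma attracted_expansive e p q : e <= 1 -> attracted p -> attracted q ->
  bclose e p q -> p = q.
Proof.
move=> e1 ap aq pq; have /andP[l1 l2] := @lam_bounds R.
have /andP[l3 l4] := @ilam_bounds R; have ll := @lamK R.
apply: sdiff_eq0; try exact: attracted_inner.
have uc0 p' q' : attracted p' -> attracted q' -> bclose e p' q' ->
    ucoord (sdiff p' q') = 0.
  by move=> ap' aq' [f _]; apply: fclose_ucoord e1 _ _ f; exact: attracted_inner.
(* This is [gmap_contract] for the preimages, read backwards in time. *)
have step p' q' : attracted p' -> attracted q' -> bclose e p' q' ->
    lam * `|scoord (sdiff p' q')| <= `|scoord (sdiff (simap p') (simap q'))|.
  move=> ap' aq' pq'.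
  have [ap1 aq1] : attracted (simap p') /\ attracted (simap q').
    by split; exact: attracted_simap.
  have [ip1 iq1] := (attracted_inner ap1, attracted_inner aq1).
  have pq1 := bclose_simap pq'.
  have d1 : `|sdiff (simap p') (simap q')| <= 1.
    by apply: le_trans (norm_sdiff _ _) (le_trans _ e1); case: pq1 => /(_ 0%N).
  have := gmap_contract (z := side true (simap p')) (w := side true (simap q')).
  rewrite !wrap_side => /(_ (attracted_norm ap1) (attracted_norm aq1) d1).
  rewrite -/(sdiff _ _) uc0// => /(_ erefl).
  rewrite -sdiff_smap// !simap_smap -(ler_pM2l (x := lam)) ?mulrA ?ll ?mul1r//.
  by lra.
apply: ucoord_scoord_inj; first by rewrite uc0// /ucoord /= addr0.
apply/eqP; rewrite /scoord [X in _ == X]/= subr0 -/(scoord _) -normr_le0.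
apply: (@lam_bounded _ 2) => n.
have : `|scoord (sdiff p q)| * lam ^+ n <=
       `|scoord (sdiff (iter n simap p) (iter n simap q))|.
  elim: n => [|n IH]; first by rewrite expr0 mulr1.
  rewrite exprSr mulrA; apply: le_trans (step _ _ _ _ _).
  - by rewrite mulrC ler_wpM2l//; lra.
  - by move=> m; rewrite -iterD.
  - by move=> m; rewrite -iterD.
  - exact: bclose_iter_simap.
have d1 : `|sdiff (iter n simap p) (iter n simap q)| <= 1.
  apply: le_trans (norm_sdiff _ _) (le_trans _ e1).
  by have [] := bclose_iter_simap n pq => /(_ 0%N).
by have := scoord_norm (sdiff (iter n simap p) (iter n simap q)); lra.
Qed.

End Dynamics.

(** * 2-expansivity and failure of expansivity *)

Section Expansivity.
Context {R : realType}.
Implicit Types (p q : surface R) (e : R) (z w : R * R).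

Lemma sqn_add_le z v (d : R) : `|z| <= 4 -> `|v| <= d -> 0 <= d <= 1 ->
  sqn (z + v) <= sqn z + 18 * d.
Proof.
rewrite !prod_norm_le; case: z v => [x y] [x' y'] /=.
move=> /and4P[a1 a2 a3 a4] /and4P[b1 b2 b3 b4] /andP[d0 d1].
(* The excess 2 s t + t^2 is at most 8 d + d. *)
have h (s t : R) : -4 <= s -> s <= 4 -> - d <= t -> t <= d ->
    (s + t) * (s + t) <= s * s + 9 * d.
  by move=> *; nra.
by rewrite /sqn /=; have := h _ _ a1 a2 b1 b2; have := h _ _ a3 a4 b3 b4; lra.
Qed.

Lemma side_shift c p q : `|side c p| <= 4 -> pdist p q <= 1 ->
  side c q = side c p + wrap (side c q - side c p).
Proof.
move=> p4 pq.
have v1 : `|wrap (side c q - side c p)| <= 1.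
  by apply: le_trans pq; rewrite -/(tnorm _) -tnormN opprB tnorm_side_le.
have <- : wrap (side c p + wrap (side c q - side c p)) =
    side c p + wrap (side c q - side c p).
  by rewrite wrapD_id wrap_side//; lra.
rewrite -[LHS](wrap_side c) -{1}(subrK (side c p) (side c q)) addrC.
by apply: wrap_congD => //; rewrite wrapK.
Qed.

Lemma tsqn_norm4 c p : tsqn (side c p) <= 16 -> `|side c p| <= 4.
Proof. by move=> q16; rewrite -wrap_side; apply: tsqn_norm_le => //; lra. Qed.

(** The constant 1 / 32 satisfies 18 / 32 < 1, so by [sqn_add_le] a point this close cannot take
    tsqn from 15 to above 16. *)
Lemma tsqn_near c p q : pdist p q <= 1 / 32 -> tsqn (side c p) <= 15 ->
  tsqn (side c q) <= 16.
Proof.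
move=> pq q15; have p4 : `|side c p| <= 4 by apply: tsqn_norm4; lra.
rewrite /tsqn wrap_side (side_shift p4); last by lra.
rewrite /tsqn wrap_side in q15.
have v : `|wrap (side c q - side c p)| <= 1 / 32.
  by apply: le_trans pq; rewrite -/(tnorm _) -tnormN opprB tnorm_side_le.
by have := sqn_add_le p4 v; lra.
Qed.

Lemma wrap_sideB c p q : tsqn (side c p) <= 16 -> tsqn (side c q) <= 16 ->
  wrap (side c p - side c q) = side c p - side c q.
Proof.
move=> /tsqn_norm4 p4 /tsqn_norm4 q4; apply: wrap_id.
by have := ler_normB (side c p) (side c q); lra.
Qed.

Lemma ucoord_sideB c p q : tsqn (side c p) <= 16 -> tsqn (side c q) <= 16 ->
  ucoord (wrap (side c p - side c q)) = 0 -> ucoord (side c p) = ucoord (side c q).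
Proof.
move=> p4 q4; rewrite wrap_sideB// /ucoord /= => e; lra.
Qed.

Lemma inner_flip p : inner (flip p) <-> tsqn (side true p) <= 16.
Proof. by rewrite /inner tsqn_side_flip. Qed.

Lemma side_flip_small c p : tsqn (side (~~ c) p) <= 16 ->
  side c (flip p) = Jmap (side (~~ c) p).
Proof.
by move=> /tsqn_norm4 p4; rewrite side_flip wrap_Jmap wrap_side//; lra.
Qed.

(** On the neck p and [flip p] are both inner, so [fclose_ucoord] applies to the future and, through
    [flip], to the past, where u becomes s on the second torus. *)
Lemma neck_close p q : 1 <= tsqn (side false p) <= lam2 -> bclose (1 / 32) p q ->
  [/\ 1 / 16 <= tsqn (side true q) <= 16,
    side false q = dilate (tsqn (side true q))^-1 (side true q),
      ucoord (side true p) = ucoord (side true q) & scoord (side false p) =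
        scoord (side false q)].
Proof.
move=> /andP[q1 qk] pq; have /andP[k1 k2] := @lam2_bounds R.
have pq0 : pdist p q <= 1 / 32 by have [/(_ 0%N)] := pq.
have ip : inner p by rewrite /inner; lra.
have iq : inner q by apply: tsqn_near pq0 _; lra.
have p1 : tsqn (side true p) <= 1.
  have p16 : 1 / 16 <= tsqn (side false p) by lra.
  by have := @tsqn_side_le _ false p p16; have := tsqn_ge0 (side true p); nra.
have q16 : tsqn (side true q) <= 16 by apply: tsqn_near pq0 _; lra.
have qr : 1 / 16 <= tsqn (side true q) <= 16 by rewrite q16 inner_tsqn.
have [f _] := pq; have [fs _] := bclose_flip pq.
split=> //.
- by rewrite -{1}(spoint_sideK (inner_tsqn iq)) (spoint_sideN true (inner_tsqn
  iq) : side false _ = _)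
    tau_inv// wrap_side.
- apply: ucoord_sideB => //; first by lra.
  by apply: fclose_ucoord ip iq f; lra.
have isp : inner (flip p) by apply/inner_flip; lra.
have isq : inner (flip q) by apply/inner_flip.
have := fclose_ucoord _ isp isq fs; rewrite /sdiff.
move=> H; have := ucoord_sideB _ _ (H _); rewrite !tsqn_side_flip /= => e.
by rewrite -!ucoord_Jmap -(@side_flip_small true p)//
  -(@side_flip_small true q)// e//; lra.
Qed.

(* Vertical lines and their images under the inversion meet in the roots of a
   quadratic equation. *)
Lemma neck_two p q1 q2 q3 : 1 <= tsqn (side false p) <= lam2 ->
  bclose (1 / 32) p q1 -> bclose (1 / 32) p q2 -> bclose (1 / 32) p q3 ->
  [\/ q1 = q2, q1 = q3 | q2 = q3].
Proof.
move=> np /(neck_close np)[r1 e1 u1 s1] /(neck_close np)[r2 e2 u2 s2].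
move=> /(neck_close np)[r3 e3 u3 s3].
(* With |z|^2 = (u^2 + s^2) / 2, this is the condition that the inverted point has s-coordinate k,
   namely s = k |z|^2. *)
have eqs q : 1 / 16 <= tsqn (side true q) <= 16 ->
    side false q = dilate (tsqn (side true q))^-1 (side true q) ->
    ucoord (side true p) = ucoord (side true q) ->
      scoord (side false p) = scoord (side false q) ->
    2 * scoord (side true q) =
    scoord (side false p) * (ucoord (side true p) ^+ 2 + scoord (side true q) ^+ 2).
  move=> /andP[r _] e -> ->.
  have qE : tsqn (side true q) = (ucoord (side true q) ^+ 2 + scoord (side true
    q) ^+ 2) / 2.
    by rewrite /tsqn wrap_side /sqn /ucoord /scoord; lra.
  have eQ : scoord (side false q) * tsqn (side true q) = scoord (side true q).
    rewrite e /scoord /dilate /= -mulrBr mulrAC mulVf ?mul1r// gt_eqF//; lra.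
  by rewrite -{1}eQ qE; lra.
have inj q q' : 1 / 16 <= tsqn (side true q) <= 16 ->
  1 / 16 <= tsqn (side true q') <= 16 ->
    ucoord (side true p) = ucoord (side true q) ->
      ucoord (side true p) = ucoord (side true q') ->
    scoord (side true q) = scoord (side true q') -> q = q'.
  move=> /andP[r _] /andP[r' _] u u' s.
  rewrite -(spoint_sideK r) -(spoint_sideK r'); congr (spoint _ _).
  by apply: ucoord_scoord_inj => //; rewrite -u.
have {s1}e1 := eqs _ r1 e1 u1 s1.
have {s2}e2 := eqs _ r2 e2 u2 s2.
have {s3}e3 := eqs _ r3 e3 u3 s3.
have [/(inj _ _ r1 r2 u1 u2) ->|n12] :=
  eqVneq (scoord (side true q1)) (scoord (side true q2)).
  by constructor 1.
have [/(inj _ _ r1 r3 u1 u3) ->|n13] :=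
  eqVneq (scoord (side true q1)) (scoord (side true q3)).
  by constructor 2.
constructor 3; apply: inj => //.
move: e1 e2 e3 n12 n13; set k := scoord (side false p); set c := ucoord _.
set x1 := scoord (side true q1); set x2 := scoord (side true q2);
  set x3 := scoord (side true q3).
rewrite -subr_eq0 -(subr_eq0 x1 x3) => e1 e2 e3 n12 n13.
(* Subtracting two equations 2 x = k (c^2 + x^2) and dividing by the difference of the roots gives 2
   = k (x1 + x2); this also shows that k is nonzero. *)
have h2 : 2 - k * (x1 + x2) = 0 by apply: (mulfI n12); rewrite mulr0; lra.
have h3 : 2 - k * (x1 + x3) = 0 by apply: (mulfI n13); rewrite mulr0; lra.
have k0 : k != 0 by apply/eqP => k0; move: h2; rewrite k0; lra.
by apply: (mulfI k0); lra.
Qed.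

Lemma card_le2 (T : choiceType) (A : set T) :
  (forall x y z : T, A x -> A y -> A z -> [\/ x = y, x = z | y = z]) ->
  (A #<= `I_2)%card.
Proof.
move=> A2; have [->|/set0P[a Aa]] := eqVneq A set0; first exact: card_ge0.
(* The element a goes to 0 and all others to 1; A has at most one other element. *)
pose g x : nat := x != a.
have gi : {in A &, injective g}.
  move=> x y /set_mem Ax /set_mem Ay; rewrite /g.
  have [->|xa] := eqVneq x a; have [->|ya] := eqVneq y a => // _.
  by have [//|e|e] := A2 _ _ _ Ax Ay Aa;
    [rewrite e eqxx in xa|rewrite e eqxx in ya].
have := inj_card_eq gi; rewrite card_eq_le => /andP[_ h].
apply: card_le_trans h _; apply: subset_card_le => _ [x _ <-].
by rewrite /g /=; case: (x != a).
Qed.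

Lemma Gamma_bclose e p q : Gamma (@shomeo R) e p q <-> bclose e p q.
Proof.
split=> [h|[f b] [n|n]].
- split=> n; first exact: (h (Posz n)).
  case: n => [|n]; first exact: (h (Posz 0)).
  exact: (h (Negz n)).
- exact: f.
- exact: (b n.+1).
Qed.

Lemma bclose_attracted p q : (forall n, tsqn (side false (iter n simap p)) <= 15) ->
  bclose (1 / 32) p q -> p = q.
Proof.
move=> p15 pq; apply: (attracted_expansive _ _ _ pq); first by lra.
  by move=> n; rewrite /inner; have := p15 n; lra.
by move=> n; apply: tsqn_near (p15 n); case: pq => _.
Qed.

(** A point beyond [lam2] lands at tsqn >= 1, so an orbit passing from the second torus to the first
    cannot jump over this annulus. *)
Lemma tsqn_simap_neck p : tsqn (side false p) <= lam2 ->
  lam2 < tsqn (side false (simap p)) ->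
  1 <= tsqn (side false p) <= lam2.
Proof.
move=> pk fk; rewrite pk andbT -(simap_smap p) smap_out//.
have q1 := tsqn_jgimap_ge (ltW fk).
by rewrite spoint_side ?(tsqn_cong (wrapK _))//; lra.
Qed.

Lemma Gamma_le2 p q1 q2 q3 :
  bclose (1 / 32) p q1 -> bclose (1 / 32) p q2 -> bclose (1 / 32) p q3 ->
  [\/ q1 = q2, q1 = q3 | q2 = q3].
Proof.
have /andP[k1 k2] := @lam2_bounds R.
(* Either the past of p never goes beyond [lam2], and p is attracted, or the last point before it
   first does so is in the neck. Closeness is invariant under the map, so the count can be made
   there and carried back by injectivity. *)
have [pk|pk] := leP (tsqn (side false p)) lam2.
  have [/asboolP all|] := boolP `[< forall n,
    tsqn (side false (iter n simap p)) <= lam2 >].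
    have p15 n : tsqn (side false (iter n simap p)) <= 15 by have := all n; lra.
    move=> /(bclose_attracted p15) <- /(bclose_attracted p15) <- _.
    by constructor 1.
  move=> /asboolPn/existsNP ex.
  have {}ex : exists n, lam2 < tsqn (side false (iter n simap p)).
    by case: ex => n /negP; rewrite -ltNge; exists n.
  case: (ex_minnP ex) => -[|n] nk nmin; first by move: nk; rewrite ltNge pk.
  have n1k : tsqn (side false (iter n simap p)) <= lam2.
    by rewrite leNgt; apply/negP => /nmin; rewrite ltnn.
  have neck := tsqn_simap_neck n1k nk.
  move=> /(bclose_iter_simap n) c1 /(bclose_iter_simap n) c2
    /(bclose_iter_simap n) c3.
  have inj := can_inj (@iter_simapK R n).
  by have [/inj|/inj|/inj] := neck_two neck c1 c2 c3;
    [constructor 1|constructor 2|constructor 3].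
(* The mirror case: either the future never comes back below [lam2], and [flip p] is attracted, or
   the first time it does gives a point in the neck. *)
have [/asboolP all|] := boolP `[< forall n,
  lam2 < tsqn (side false (iter n smap p)) >].
  have p15 n : tsqn (side false (iter n simap (flip p))) <= 15.
    rewrite iter_simap_flip tsqn_side_flip /=; have qn := all n.
    have q16 : 1 / 16 <= tsqn (side false (iter n smap p)) by lra.
    have := @tsqn_side_le _ false _ q16.
    by have := tsqn_ge0 (side true (iter n smap p)); rewrite /=; nra.
  move=> /bclose_flip/(bclose_attracted p15) e1 /bclose_flip/(bclose_attracted
    p15) e2 _.
  by constructor 1; rewrite -(flipK q1) -e1 e2 flipK.
move=> /asboolPn/existsNP ex.
have {}ex : exists n, tsqn (side false (iter n smap p)) <= lam2.
  by case: ex => n /negP; rewrite -leNgt; exists n.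
case: (ex_minnP ex) => -[|n] nk nmin; first by move: nk; rewrite leNgt pk.
have n1k : lam2 < tsqn (side false (iter n smap p)).
  by rewrite ltNge; apply/negP => /nmin; rewrite ltnn.
have neck : 1 <= tsqn (side false (iter n.+1 smap p)) <= lam2.
  by apply: tsqn_simap_neck => //=; rewrite smap_simap.
move=> /(bclose_iter_smap n.+1) c1 /(bclose_iter_smap n.+1) c2
  /(bclose_iter_smap n.+1) c3.
have inj := can_inj (@iter_smapK R n.+1).
by have [/inj|/inj|/inj] := neck_two neck c1 c2 c3;
  [constructor 1|constructor 2|constructor 3].
Qed.

Lemma shomeo_2_expansive : n_expansive 2 (@shomeo R).
Proof.
exists (1 / 32); first by lra.
move=> p; apply: card_le2 => q1 q2 q3 /Gamma_bclose c1 /Gamma_bclose c2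
  /Gamma_bclose c3.
exact: Gamma_le2 c1 c2 c3.
Qed.

(** * Distinct orbits close to the tangency *)

Lemma iter_smap_near p e n : 0 < e -> exists2 d : R, 0 < d &
  forall q, pdist p q < d -> pdist (iter n smap p) (iter n smap q) < e.
Proof.
elim: n e => [|n IH] e e0; first by exists e.
have /near_mdistP/(_ e e0)/nbhs_ballP[d /= d0 h] :=
  @smap_continuous R (iter n smap p).
have [d' d'0 h'] := IH d d0; exists d' => // q /h' pq.
by have := h (iter n smap q); rewrite ballEmdist /= => /(_ pq).
Qed.

Lemma iter_smap_near_le p e n : 0 < e -> exists2 d : R, 0 < d &
  forall q m, (m <= n)%N -> pdist p q < d ->
  pdist (iter m smap p) (iter m smap q) < e.
Proof.
move=> e0; elim: n => [|n [d d0 h]].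
  by exists e => // q m; rewrite leqn0 => /eqP ->.
have [d' d'0 h'] := iter_smap_near p n.+1 e0.
exists (Num.min d d'); first by rewrite lt_min d0.
move=> q m; rewrite lt_min leq_eqVlt => /orP[/eqP ->|mn] /andP[qd qd'].
  exact: h'.
exact: h.
Qed.

(** At (1, 0) both u and s equal 1. The inversion sends the line s = 1 to the curve 2 s = u^2 + s^2,
    which meets u = 1 where (s - 1)^2 = 0: a double root. *)
Definition tangency : surface R := spoint true (1, 0).

Lemma side_tangency c : side c tangency = (1, 0).
Proof.
have q : 1 / 16 <= tsqn (1, 0 : R) by rewrite tsqn_unit; lra.
case: c; first by rewrite spoint_side// wrap_unit.
by rewrite /tangency spoint_unit spoint_side// wrap_unit.
Qed.

Lemma flip_tangency : flip tangency = tangency.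
Proof.
apply: (@side_inj _ true); rewrite side_flip !side_tangency /Jmap /= oppr0;
  exact: wrap_unit.
Qed.

(** Continuity of finitely many iterates handles the first N steps. After them both orbits stay
    outside the ball of radius 5 lam, where the u-difference remains 0, the s-difference contracts
    and the second components are eventually 0. *)
Lemma fclose_tangency e : 0 < e <= 1 -> exists2 d : R, 0 < d &
  forall p q, pdist tangency p < d -> pdist tangency q < d ->
  ucoord (sdiff p q) = 0 -> fclose e p q.
Proof.
move=> /andP[e0 e1]; have /andP[l1 l2] := @lam_bounds R.
have /andP[l3 l4] := @ilam_bounds R.
(* Starting at norm at least 1 / 2, dilation for N steps would exceed 5 lam, so by [norm_side_iter]
   the orbit is outside that ball from time N on. *)
have [N lN] : exists N : nat, 10 * lam < lam ^+ N :> R.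
  exists (Num.truncn (10 * lam : R)).+1.
  exact: lt_le_trans (truncnS_gt _) (lam_expr_ge _).
have e20 : 0 < e / 2 by rewrite divr_gt0.
have [d d0 dN] := iter_smap_near_le tangency N e20.
exists (Num.min d (1 / 32)); first by rewrite lt_min d0 /=; lra.
move=> p q; rewrite !lt_min => /andP[pd p32] /andP[qd q32] u0.
have nz : `|((1, 0) : R * R)| = 1 by rewrite prod_normE /= normr0 normr1 max_l.
have start r : pdist tangency r < 1 / 32 -> inner r /\ 1 / 2 <= `|side true r|.
  move=> tr; split.
    by apply: tsqn_near (ltW tr) _; rewrite side_tangency tsqn_unit; lra.
  rewrite (@side_shift true tangency r) ?side_tangency ?nz//; [|lra|lra].
  set v := wrap (side true r - (1, 0)).
  have v1 : `|v| < 1 / 32.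
    apply: le_lt_trans tr; rewrite pdist_sym.
    by have := tnorm_side_le true r tangency; rewrite side_tangency.
  have v2 : 1 - `|v| <= `|(1, 0) + v| by rewrite -[X in X - _]nz; exact: lerB_normD.
  by lra.
have [ip np] := start p p32; have [iq nq] := start q q32.
have far (r : surface R) n : inner r -> 1 / 2 <= `|side true r| -> (N <= n)%N ->
    5 * lam < `|side true (iter n smap r)|.
  move=> ir nr Nn; rewrite ltNge; apply/negP => r5.
  have e2 := norm_side_iter ir r5.
  have l5 : lam ^+ N <= lam ^+ n :> R by rewrite ler_weXn2l//; lra.
  by nra.
have small n : (n <= N)%N -> pdist (iter n smap p) (iter n smap q) <= e.
  move=> nN; have := dN p n nN pd; have := dN q n nN qd.
  have := pdist_triangle (iter n smap tangency) (iter n smap p) (iter n smap q).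
  by rewrite (pdist_sym _ (iter n smap tangency)); lra.
suff H n : pdist (iter n smap p) (iter n smap q) <= e /\
    ucoord (sdiff (iter n smap p) (iter n smap q)) = 0 by move=> n; case: (H n).
elim: n => [|n [IH1 IH2]]; first by split=> //; exact: small.
have [ipn iqn] := (inner_iter n ip, inner_iter n iq).
have un : ucoord (sdiff (iter n.+1 smap p) (iter n.+1 smap q)) = 0.
  by rewrite !iterS ucoord_sdiff_smap ?IH2 ?mulr0//; lra.
split=> //; have [/small//|Nn] := leqP n.+1 N; rewrite ltnS in Nn.
have d1 : `|sdiff (iter n smap p) (iter n smap q)| <= 1.
  exact: le_trans (norm_sdiff _ _) (le_trans IH1 e1).
have c : `|scoord (sdiff (iter n.+1 smap p) (iter n.+1 smap q))| <=
    ilam * `|scoord (sdiff (iter n smap p) (iter n smap q))|.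
  rewrite !iterS sdiff_smap//; apply: gmap_contract => //; rewrite wrap_side;
    exact: far.
have h1 := ucoord_scoord_norm (sdiff (iter n.+1 smap p) (iter n.+1 smap q)).
have h2 := ucoord_scoord_norm (sdiff (iter n smap p) (iter n smap q)).
rewrite un normr0 in h1; rewrite IH2 normr0 in h2.
(* Far from the neck the cut-off inversion is exactly 0, so the second components coincide. *)
have zero (r : surface R) : inner r -> 1 / 2 <= `|side true r| ->
    side false (iter n.+1 smap r) = 0.
  move=> ir nr; have irn := inner_iter n ir.
  have := far r n.+1 ir nr (leqW Nn); rewrite iterS side_smap// => /lt_trans h.
  have q300 : 300 < tsqn (gmap (side true (iter n smap r))).
    apply: tsqn_gmap_large; have := far r n.+1 ir nr (leqW Nn).
    by rewrite iterS side_smap.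
  have q16 : 1 / 16 <= tsqn (gmap (side true (iter n smap r))) by lra.
  rewrite smap_in// (spoint_sideN true q16 : side false _ = _) /tau
    invcut_zero; last by lra.
  by rewrite /dilate !mul0r.
apply: (@pdist_le _ true) => /=.
  have := norm_sdiff (iter n smap p) (iter n smap q).
  have := normr_ge0 (scoord (sdiff (iter n smap p) (iter n smap q))).
  by rewrite -/(sdiff _ _) /tnorm -/(sdiff _ _) -!iterS; nra.
by rewrite -!iterS !zero// subrr tnorm0 ltW.
Qed.

Definition tpoint (t : R) : R * R := ((1 + t) / 2, (1 - t) / 2).

Lemma scoord_tpoint t : scoord (tpoint t) = t.
Proof. by rewrite /scoord /=; lra. Qed.

Lemma continuous_tpoint : continuous tpoint.
Proof.
have ci : continuous (fun t : R => t) by move=> t; exact: cvg_id.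
have cc (x : R) : continuous (fun _ : R => x) by exact: continuous_cstr.
apply: continuous_pair; apply: continuous_mulr => //.
  exact: continuous_addr (cc 1) ci.
exact: continuous_addr (cc 1) (continuous_oppr ci).
Qed.

Lemma tpoint_near (d : R) : 0 < d -> exists2 h : R, 0 < h &
  forall t, `|1 - t| < h -> pdist tangency (spoint true (tpoint t)) < d.
Proof.
move=> d0; have t1 : tpoint 1 = (1, 0) by congr pair; lra.
have ct : {for 1, continuous (spoint true \o tpoint)}.
  apply: continuous_comp; first exact: continuous_tpoint.
  by apply: spoint_continuous; rewrite t1 tsqn_unit; lra.
have : \forall t \near (1 : R),
    mdist (spoint true (tpoint 1)) (spoint true (tpoint t)) < d.
  exact: (metricType_numDomainType.cvgr_dist_lt ct).
by rewrite t1 => /nbhs_ballP[h /= h0 H]; exists h.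
Qed.

(** Take the points of the line u = 1 with s = t and s = 1 / t. Inversion turns s into 2 t / (1 +
    t^2), which is invariant under t -> 1 / t. So the pair lies on a vertical line on one torus and
    on a horizontal line on the other, and both time directions follow from [fclose_tangency]. *)
Lemma shomeo_not_expansive : ~ expansive (@shomeo R).
Proof.
case=> alpha a0 aG; pose e := Num.min alpha 1.
have e01 : 0 < e <= 1 by rewrite lt_min a0 ltr01 ge_min lexx orbT.
have [d d0 dH] := fclose_tangency e01.
have [h h0 hH] := tpoint_near d0.
(* With 0 < k < h, both 1 + k and its inverse, which exceeds 1 - k, are within h of 1. *)
pose k := Num.min h (1 / 2) / 2.
have kh : k < h /\ 0 < k < 1 / 2.
  by rewrite /k; case: (leP h (1 / 2)) => ?; split; try (apply/andP; split); lra.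
have [{}kh /andP[k0 k1]] := kh.
pose t := 1 + k; pose s := t^-1.
have t0 : 0 < t by rewrite /t; lra.
have ts : t * s = 1 by rewrite divff// gt_eqF.
have s0 : 0 < s by rewrite invr_gt0.
have tn : `|1 - t| < h by rewrite /t opprD addrA subrr add0r normrN gtr0_norm.
have s1 : 1 - k < s < 1 by apply/andP; split; rewrite /t in ts; nra.
have sn : `|1 - s| < h.
  by move: s1 => /andP[? ?]; rewrite gtr0_norm; lra.
have Qt (r : R) : 0 < r < 2 -> wrap (tpoint r) = tpoint r /\
    tsqn (tpoint r) = (1 + r * r) / 2.
  move=> /andP[r0 r2].
  have w : wrap (tpoint r) = tpoint r.
    by rewrite wrap_id// prod_norm_lt /=; apply/and4P; split; lra.
  by split=> //; rewrite /tsqn w /sqn /=; lra.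
have [wt qt] : wrap (tpoint t) = tpoint t /\ tsqn (tpoint t) = (1 + t * t) / 2.
  by apply: Qt; rewrite t0 /t; lra.
have [ws qs] : wrap (tpoint s) = tpoint s /\ tsqn (tpoint s) = (1 + s * s) / 2.
  by apply: Qt; move: s1 => /andP[? ?]; rewrite s0 /=; lra.
have qtr : 1 / 16 <= tsqn (tpoint t) <= 16.
  by rewrite qt /t; apply/andP; split; nra.
have qsr : 1 / 16 <= tsqn (tpoint s) <= 16.
  by move: s1 => /andP[? ?]; rewrite qs; apply/andP; split; nra.
have [qt16 qs16] : 1 / 16 <= tsqn (tpoint t) /\ 1 / 16 <= tsqn (tpoint s).
  by move: qtr qsr => /andP[? _] /andP[? _].
pose p := spoint true (tpoint t); pose q := spoint true (tpoint s).
have pd := hH t tn; have qd := hH s sn.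
have cp : side true p = tpoint t by rewrite spoint_side.
have cq : side true q = tpoint s by rewrite spoint_side.
have fpq : fclose e p q.
  apply: dH => //; rewrite /sdiff wrap_sideB ?cp ?cq.
  - by rewrite /ucoord /=; lra.
  - by move: qtr => /andP[].
  - by move: qsr => /andP[].
have cp' : side false p = tau (tpoint t) := spoint_sideN true qt16.
have cq' : side false q = tau (tpoint s) := spoint_sideN true qs16.
have Qp' : tsqn (side false p) <= 16.
  by rewrite cp' tsqn_tau_inv//; have /andP[] := inv_range qtr.
have Qq' : tsqn (side false q) <= 16.
  by rewrite cq' tsqn_tau_inv//; have /andP[] := inv_range qsr.
have scE : scoord (side false p) = scoord (side false q).
  rewrite cp' cq' !tau_inv// wt ws.
  have scdil (c : R) z : scoord (dilate c z) = c * scoord z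
    by rewrite /scoord /=; lra.
  rewrite !scdil !scoord_tpoint qt qs.
  have nt : 1 + t * t != 0 by rewrite gt_eqF//; nra.
  have ns : 1 + s * s != 0 by rewrite gt_eqF//; nra.
  rewrite !invf_div mulrAC [RHS]mulrAC; apply/eqP.
  by rewrite eqr_div//; apply/eqP; nra.
have fspq : fclose e (flip p) (flip q).
  apply: dH; first by rewrite -flip_tangency pdist_flip.
    by rewrite -flip_tangency pdist_flip.
  rewrite /sdiff wrap_sideB ?tsqn_side_flip// (@side_flip_small true p)//
    (@side_flip_small true q)//.
  by rewrite -JmapB ucoord_Jmap; move: scE; rewrite /scoord /=; lra.
have : Gamma (@shomeo R) alpha p q.
  apply/Gamma_bclose; have [f b] := bcloseE fpq fspq.
  by split=> n; [apply: le_trans (f n) _|apply: le_trans (b n) _];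
    rewrite ge_min lexx.
rewrite aG /= => /(congr1 (side true)); rewrite cp cq => /(congr1 scoord).
rewrite !scoord_tpoint => st; move: s1 => /andP[_]; rewrite st /t; lra.
Qed.

End Expansivity.

Theorem theorem2 (R : realType) :
  exists (M : metricType R) (f : homeomorphism M M),
    [/\ compact_boundaryless_surface M, n_expansive 2 f & ~ expansive f].
Proof.
exists (surface R), shomeo; split.
- exact: surface_closed.
- exact: shomeo_2_expansive.
- exact: shomeo_not_expansive.
Qed.
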